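(* Let $(X,\mathscr A,\mu)$ be a $\sigma$-finite measure space, let $\phi\colon X\to X$ and $w\colon X\to\mathbb C$ be $\mathscr A$-measurable, and let the weighted composition operator $C_{\phi,w}$ in $L^2(\mu)$ be well defined. Assume that $C_{\phi,w}^n$ is closed for every $n\in\mathbb N$ and that $\mathcal D^\infty(C_{\phi,w}):=\bigcap_{n=1}^\infty\mathcal D(C_{\phi,w}^n)$ is dense in $L^2(\mu)$. Then $C_{\phi,w}$ is spectrally half-centered.
   Context: $\mathbb N=\{1,2,\dots\}$; $\mathcal D(A)$ is the domain of a (possibly unbounded) operator $A$. Put $\mu_w(\sigma)=\int_\sigma|w|^2\,d\mu$ for $\sigma\in\mathscr A$. $C_{\phi,w}$ is well defined if the measure $\sigma\mapsto\mu_w(\phi^{-1}(\sigma))$ is absolutely continuous with respect to $\mu$; then $\mathcal D(C_{\phi,w})=\{f\in L^2(\mu): w\cdot(f\circ\phi)\in L^2(\mu)\}$ and $C_{\phi,w}f=w\cdot(f\circ\phi)$. Let $T$ be an operator in a complex Hilbert space such that $T^n$ is densely defined and closed for every $n\in\mathbb N$; then each $T^{n*}T^n$ (where $T^{n*}=(T^n)^*$) is selfadjoint, and $E_{1,n}$ denotes its spectral measure. $T$ is called spectrally half-centered if $E_{1,n}(\sigma)E_{1,m}(\omega)=E_{1,m}(\omega)E_{1,n}(\sigma)$ for all Borel sets $\sigma,\omega\subseteq\mathbb C$ and all $n,m\in\mathbb N$. *)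

(* Defs.v *)
From HB Require Import structures.
From mathcomp Require Import all_boot all_order all_algebra.
From mathcomp Require Import ring lra ring_quotient.
From mathcomp Require Import complex.
From mathcomp Require Import all_classical all_reals all_analysis.
From mathcomp Require Import measurable_realfun.
Set Implicit Arguments. Unset Strict Implicit. Unset Printing Implicit Defensive.
Import Order.TTheory GRing.Theory Num.Theory.
Import numFieldNormedType.Exports.
Local Open Scope classical_set_scope.
Local Open Scope ring_scope.
Local Open Scope complex_scope.

Section borelC.
Context (R : realType).
HB.instance Definition _ := isPointed.Build R[i] 0.
(* The Borel sigma-algebra of the complex plane, for the norm topology. *)
HB.instance Definition _ := @isMeasurable.Build default_measure_display R[i]
  <<s @open (R[i] : numFieldType) >> (@sigma_algebra0 _ setT _)
  (@sigma_algebraC _ _) (@sigma_algebra_bigcup _ setT _).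

Lemma open_measurableC (U : set R[i]) :
  (forall z, U z -> exists2 e : R, 0 < e & forall y, `|z - y| < e%:C -> U y) ->
  measurable U.
Proof.
move=> h; apply: sub_sigma_algebra; rewrite openE => z /h[e e0 eU].
by apply/nbhs_ballP; exists e%:C => //=; rewrite ltcR.
Qed.

Definition sqnorm (z : R[i]) : R := complex.Re z ^+ 2 + complex.Im z ^+ 2.

Lemma normc_lt (z : R[i]) (e : R) : 
  `|complex.Re z| + `|complex.Im z| < e -> `|z| < e%:C.
Proof.
case: z => a b /= h; rewrite normc_def ltcR /=.
apply: le_lt_trans h.
rewrite -[leRHS]ger0_norm ?addr_ge0// -sqrtr_sqr ler_wsqrtr// sqrrD !real_normK ?num_real//.
by rewrite addrAC lerDl mulrn_wge0// mulr_ge0.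
Qed.

Lemma measurable_Re : measurable_fun [set: R[i]] (@complex.Re R).
Proof.
apply: (measurability _ (RGenOInfty.measurableE R)) => _ [_ [x ->] <-].
rewrite setTI; apply: open_measurableC => z /= /[!in_itv]/= /[!andbT] xz.
exists (complex.Re z - x); first by rewrite subr_gt0.
move=> y yz; rewrite in_itv/= andbT.
have := le_lt_trans (normc_ge_Re _) yz.
rewrite ltcR; case: (y) (z) xz => a b [c e] /=.
by move=> xz; rewrite ltr_norml => /andP[_]; lra.
Qed.

Lemma measurable_Im : measurable_fun [set: R[i]] (@complex.Im R).
Proof.
rewrite (_ : @complex.Im R = (fun z => - complex.Re ('i * z))); last first.
  by apply/funext => z; rewrite mulrC ReiNIm opprK.
apply: measurableT_comp => //.
apply: (measurability _ (RGenOInfty.measurableE R)) => _ [_ [x ->] <-].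
rewrite setTI; apply: open_measurableC => z /= /[!in_itv]/= /[!andbT] xz.
exists (complex.Re ('i * z) - x); first by rewrite subr_gt0.
move=> y yz; rewrite in_itv/= andbT.
have : `|('i : R[i]) * z - 'i * y| < (complex.Re ('i * z) - x)%:C.
  by rewrite -mulrBr normrM [X in X * _]normc_def /= expr0n expr1n add0r sqrtr1 mul1r.
move/(le_lt_trans (normc_ge_Re _)).
rewrite ltcR; move: xz; case: ('i * z) ('i * y) => a b [c e] /=.
by move=> xz; rewrite ltr_norml => /andP[_]; lra.
Qed.

Lemma rat_near (x v : R) : 0 < v -> exists q : rat, `|x - ratr q| < v.
Proof.
move=> v0; have [|q] := @rat_in_itvoo R (x - v) (x + v); first lra.
rewrite in_itv/= => /andP[? ?]; exists q; rewrite ltr_norml; apply/andP; split; lra.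
Qed.

Lemma measurable_complexP d (X : measurableType d) (f : X -> R[i]) :
  measurable_fun setT f <->
  measurable_fun setT (@complex.Re R \o f) /\
  measurable_fun setT (@complex.Im R \o f).
Proof.
split=> [mf|[mr mi]].
  by split; apply: measurableT_comp => //; [exact: measurable_Re|exact: measurable_Im].
apply: (@measurability _ _ _ _ _ _ (@open (R[i] : numFieldType))) => // _ [U oU <-].
rewrite setTI.
pose box (t : rat * rat * nat) := [set z : R[i] |
  `|complex.Re z - ratr t.1.1| < t.2.+1%:R^-1 /\ `|complex.Im z - ratr t.1.2| < t.2.+1%:R^-1].
have -> : f @^-1` U = \bigcup_(t in [set t | box t `<=` U]) (f @^-1` box t).
  apply/seteqP; split=> [x Ux|x [t /= tU]]; last exact: tU.
  move: oU; rewrite openE => /(_ _ Ux) /nbhs_ballP[[e e']] /=.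
  rewrite ltcE/= => /andP[/eqP ->] e0 eU.
  have [k _ /(_ k (leqnn _)) /= ke] := near_infty_natSinv_lt (PosNum (divr_gt0 e0 (ltr0n R 4))).
  have k0 : 0 < k.+1%:R^-1 :> R by rewrite invr_gt0.
  have [a ra] := rat_near (complex.Re (f x)) k0.
  have [b rb] := rat_near (complex.Im (f x)) k0.
  exists (a, b, k) => //= z [/= za zb]; apply: eU.
  rewrite /ball/=; apply: normc_lt.
  move: ke ra rb za zb; rewrite /=; case: (f x) z => [p q] [r s] /=.
  move: (k.+1%:R^-1) => v ke; rewrite !ltr_norml => /andP[? ?] /andP[? ?] /andP[? ?] /andP[? ?].
  have : `|p - r| < 2 * v by rewrite ltr_norml; apply/andP; split; lra.
  have : `|q - s| < 2 * v by rewrite ltr_norml; apply/andP; split; lra.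
  lra.
rewrite bigcup_mkcond; apply: countable_bigcupT_measurable => [|t]; first exact: countableP.
case: ifPn => // _.
have mb (g : X -> R) q v : measurable_fun setT g ->
    measurable [set x | `|g x - q| < v].
  move=> mg; rewrite -[X in measurable X]setTI.
  have mh : measurable_fun setT (fun x => `|g x - q|).
    by apply: measurableT_comp => //; exact: measurable_funB.
  have := mh measurableT [set` `]-oo, v[] (measurable_itv _).
  by congr (measurable (_ `&` _)); apply/funext => x; rewrite /= in_itv.
exact: (measurableI _ _ (mb _ _ _ mr) (mb _ _ _ mi)).
Qed.

End borelC.

Section L2.
Context d (X : measurableType d) (R : realType) (mu : {measure set X -> \bar R}).
Implicit Types f g : X -> R[i].

Definition square_integrable f :=
  measurable_fun setT f /\ (\int[mu]_x (sqnorm (f x))%:E < +oo)%E.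

Definition sqint : {pred X -> R[i]} := [pred f | `[< square_integrable f >]].

Lemma measurable_complex_scale (a : R[i]) f :
  measurable_fun setT f -> measurable_fun setT (fun x => a * f x).
Proof.
move=> /measurable_complexP[mr mi]; apply/measurable_complexP; split.
- rewrite (_ : _ \o _ = (fun x => complex.Re a * complex.Re (f x) - complex.Im a * complex.Im (f x))).
    by apply: measurable_funB; apply: measurable_funM.
  by apply/funext => x /=; case: a (f x) => ? ? [? ?].
- rewrite (_ : _ \o _ = (fun x => complex.Re a * complex.Im (f x) + complex.Im a * complex.Re (f x))).
    by apply: measurable_funD; apply: measurable_funM.
  by apply/funext => x /=; case: a (f x) => ? ? [? ?].
Qed.

Lemma measurable_complexD f g : measurable_fun setT f ->
  measurable_fun setT g -> measurable_fun setT (f \+ g).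
Proof.
move=> /measurable_complexP[fr fi] /measurable_complexP[gr gi].
apply/measurable_complexP; split.
- rewrite (_ : _ \o _ = (@complex.Re R \o f) \+ (@complex.Re R \o g)).
    exact: measurable_funD.
  by apply/funext => x /=; case: (f x) (g x) => ? ? [? ?].
- rewrite (_ : _ \o _ = (@complex.Im R \o f) \+ (@complex.Im R \o g)).
    exact: measurable_funD.
  by apply/funext => x /=; case: (f x) (g x) => ? ? [? ?].
Qed.

Lemma measurable_sqnorm f :
  measurable_fun setT f -> measurable_fun setT (fun x => sqnorm (f x)).
Proof.
move=> /measurable_complexP[mr mi].
by apply: measurable_funD; apply: (measurable_funX 2).
Qed.

Lemma sqnorm_ge0 (z : R[i]) : 0 <= sqnorm z.
Proof. by rewrite addr_ge0// sqr_ge0. Qed.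

Lemma sqnormM (a z : R[i]) : sqnorm (a * z) = sqnorm a * sqnorm z.
Proof. by case: a z => ? ? [? ?]; rewrite /sqnorm/=; ring. Qed.

Lemma sqnormD (y z : R[i]) : sqnorm (y + z) <= 2 * sqnorm y + 2 * sqnorm z.
Proof.
case: y z => a b [c e]; rewrite /sqnorm/= -subr_ge0.
rewrite (_ : _ - _ = (a - c) ^+ 2 + (b - e) ^+ 2); last ring.
by rewrite addr_ge0// sqr_ge0.
Qed.

Lemma sqint_submod_closed : submod_closed sqint.
Proof.
split.
  apply/asboolP; split; first exact: measurable_cst.
  by under eq_integral do rewrite /sqnorm/= !expr0n addr0; rewrite integral0.
move=> a f g /asboolP[mf fi] /asboolP[mg gi]; apply/asboolP; split.
  by apply: (@measurable_complexD (fun x => a * f x)) => //; exact: measurable_complex_scale.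
pose h x := ((2 * sqnorm a)%:E * (sqnorm (f x))%:E + 2%:E * (sqnorm (g x))%:E)%E.
have h0 (z : R[i]) : (0 <= (sqnorm z)%:E)%E by rewrite lee_fin; exact: sqnorm_ge0.
have ms (k : X -> R[i]) : measurable_fun setT k -> measurable_fun setT (fun x => (sqnorm (k x))%:E).
  by move=> mk; apply/measurable_EFinP; exact: measurable_sqnorm.
apply: (@le_lt_trans _ _ (\int[mu]_x h x)%E).
  apply: ge0_le_integral => //=.
  - by apply: ms; apply: (@measurable_complexD (fun x => a * f x)) => //; exact: measurable_complex_scale.
  - by apply: emeasurable_funD; apply: measurable_funeM; exact: ms.
  - move=> x _; rewrite /h -!EFinM -EFinD lee_fin -mulrA -sqnormM; exact: sqnormD.
have a0 : 0 <= 2 * sqnorm a by rewrite mulr_ge0// sqnorm_ge0.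
rewrite ge0_integralD//=.
- rewrite !ge0_integralZl//=; [|exact: ms..].
  by rewrite lte_add_pinfty// lte_mul_pinfty.
- by move=> x _; rewrite mule_ge0.
- by apply: measurable_funeM; exact: ms.
- by move=> x _; rewrite mule_ge0.
- by apply: measurable_funeM; exact: ms.
Qed.

HB.instance Definition _ :=
  GRing.isSubmodClosed.Build R[i] (X -> R[i]) sqint sqint_submod_closed.

Record L2fun := MkL2fun { L2val :> X -> R[i] ; L2valP : L2val \in sqint }.
HB.instance Definition _ := [isSub for L2val].
HB.instance Definition _ := [Choice of L2fun by <:].
HB.instance Definition _ := [SubChoice_isSubLmodule of L2fun by <:].

Definition ae_zero : {pred L2fun} :=
  [pred f : L2fun | `[< {ae mu, forall x, f x = 0} >]].

Lemma ae_zero_zmod_closed : zmod_closed ae_zero.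
Proof.
split; first by apply/asboolP; apply: aeW.
move=> f g /asboolP f0 /asboolP g0; apply/asboolP.
apply: filterS2 f0 g0 => x fx gx.
by rewrite -[LHS]/(f x - g x) fx gx subr0.
Qed.

HB.instance Definition _ :=
  GRing.isZmodClosed.Build L2fun ae_zero ae_zero_zmod_closed.

Definition L2 : Type := Quotient.quot ae_zero.
HB.instance Definition _ := Choice.on L2.
HB.instance Definition _ := GRing.Zmodule.on L2.
HB.instance Definition _ : EqQuotient L2fun (Quotient.equiv ae_zero) L2 := EqQuotient.on L2.


Local Open Scope quotient_scope.

Lemma L2_eqP (f g : L2fun) :
  \pi_L2 f = \pi_L2 g <-> {ae mu, forall x, f x = g x}.
Proof.
split=> [/eqmodP|fg]; last apply/eqmodP.
  move=> /asboolP; apply: filterS => x.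
  by rewrite -[LHS]/(f x - g x) => /eqP; rewrite subr_eq0 => /eqP.
apply/asboolP; apply: filterS fg => x fg.
by rewrite -[LHS]/(f x - g x) fg subrr.
Qed.

Lemma L2_reprE (f : L2fun) : {ae mu, forall x, repr (\pi_L2 f) x = f x}.
Proof. by apply/L2_eqP; rewrite reprK. Qed.

Definition L2_scale (a : R[i]) (F : L2) : L2 := \pi_L2 (a *: repr F).

Lemma pi_scale a (f : L2fun) : L2_scale a (\pi_L2 f) = \pi_L2 (a *: f).
Proof.
apply/L2_eqP; apply: filterS (L2_reprE f) => x fx.
exact: (congr1 (fun z => a * z) fx).
Qed.

Lemma pi_L2D (f g : L2fun) : \pi_L2 (f + g) = \pi_L2 f + \pi_L2 g.
Proof. exact: raddfD. Qed.

Let scaleA a b F : L2_scale a (L2_scale b F) = L2_scale (a * b) F.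
Proof. by elim/quotW: F => f; rewrite (pi_scale b) pi_scale scalerA -pi_scale. Qed.
Let scale1 : left_id 1 L2_scale.
Proof. by elim/quotW => f; rewrite pi_scale scale1r. Qed.
Let scaleDr : right_distributive L2_scale +%R.
Proof.
by move=> a; elim/quotW => f; elim/quotW => g; rewrite -pi_L2D !pi_scale scalerDr pi_L2D.
Qed.
Let scaleDl F : {morph L2_scale^~ F : a b / a + b}.
Proof. by elim/quotW: F => f a b; rewrite !pi_scale scalerDl pi_L2D. Qed.

HB.instance Definition _ := GRing.Zmodule_isLmodule.Build R[i] L2
  scaleA scale1 scaleDr scaleDl.

End L2.

(* [nu] is a bare set function, so that the integral can also be taken against
   [fun s => <E s x, x>] without bundling the latter as a measure; on a measure
   both parts are [Rintegral]s. *)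
Definition cintegral d (T : measurableType d) (R : realType)
    (nu : set T -> \bar R) (f : T -> R[i]) : R[i] :=
  fine (\int[nu]_x (complex.Re (f x))%:E) +i*
  fine (\int[nu]_x (complex.Im (f x))%:E).

Section dot.
Context d (X : measurableType d) (R : realType) (mu : {measure set X -> \bar R}).
Implicit Types f g : X -> R[i].
Local Open Scope quotient_scope.

(* Linear in the first argument, conjugate-linear in the second. *)
Definition L2dot (F G : L2 mu) : R[i] :=
  cintegral mu (fun x => repr F x * (repr G x)^*).

Lemma cintegralE f : cintegral mu f =
  (\int[mu]_x complex.Re (f x)) +i* (\int[mu]_x complex.Im (f x)).
Proof. by []. Qed.

Definition cintegrable f :=
  mu.-integrable setT (EFin \o (@complex.Re R \o f)) /\
  mu.-integrable setT (EFin \o (@complex.Im R \o f)).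

Lemma cintegralZD a f g : cintegrable f -> cintegrable g ->
  cintegral mu (fun x => a * f x + g x) = a * cintegral mu f + cintegral mu g.
Proof.
move=> [fr fi] [gr gi].
have iZ k (h : X -> R) : mu.-integrable setT (EFin \o h) ->
    mu.-integrable setT (EFin \o (fun x => k * h x)).
  by move=> ih; exact: (integrableZl measurableT k ih).
have iD (h k : X -> R) : mu.-integrable setT (EFin \o h) ->
    mu.-integrable setT (EFin \o k) ->
    mu.-integrable setT (EFin \o (fun x => h x + k x)).
  by move=> ih ik; exact: (integrableD measurableT ih ik).
rewrite !cintegralE (_ : (fun x => complex.Re (a * f x + g x)) = (fun x =>
  complex.Re a * complex.Re (f x) + (- complex.Im a * complex.Im (f x) + complex.Re (g x)))); last first.
  by apply/funext => x; case: a (f x) (g x) => ? ? [? ?] [? ?] /=; ring.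
rewrite (_ : (fun x => complex.Im (a * f x + g x)) = (fun x =>
  complex.Re a * complex.Im (f x) + (complex.Im a * complex.Re (f x) + complex.Im (g x)))); last first.
  by apply/funext => x; case: a (f x) (g x) => ? ? [? ?] [? ?] /=; ring.
rewrite !RintegralD ?RintegralZl//; try (by exact: iZ); try (by apply: iD => //; exact: iZ).
by case: a => p q; simpc => /=; congr (_ +i* _); ring.
Qed.

Lemma cintegral_conj f : cintegrable f ->
  cintegral mu (fun x => (f x)^*) = (cintegral mu f)^*.
Proof.
move=> [fr fi]; rewrite !cintegralE.
rewrite (_ : (fun x => complex.Re _) = (fun x => complex.Re (f x))); last first.
  by apply/funext => x; case: (f x).
rewrite (_ : (fun x => complex.Im (f x)^*) = (fun x => -1 * complex.Im (f x))); last first.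
  by apply/funext => x; case: (f x) => ? ? /=; rewrite mulN1r.
by rewrite RintegralZl//= mulN1r.
Qed.

Lemma ae_eq_cintegral f g : measurable_fun setT f -> measurable_fun setT g ->
  {ae mu, forall x, f x = g x} -> cintegral mu f = cintegral mu g.
Proof.
move=> /measurable_complexP[fr fi] /measurable_complexP[gr gi] fg.
by congr (fine _ +i* fine _); apply: ae_eq_integral => //;
  try exact/measurable_EFinP; apply: filterS fg => x ->.
Qed.

Lemma L2fun_measurable (f : L2fun mu) : measurable_fun setT f.
Proof. by case: f => f /= /asboolP[]. Qed.

Lemma L2fun_integrable (f : L2fun mu) :
  mu.-integrable setT (EFin \o (fun x => sqnorm (f x))).
Proof.
case: f => f /= /asboolP[mf fi]; apply/integrableP; split.
  exact/measurable_EFinP/measurable_sqnorm.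
under eq_integral do rewrite /= ger0_norm ?sqnorm_ge0//.
exact: fi.
Qed.

Lemma measurable_mul_conj f g : measurable_fun setT f -> measurable_fun setT g ->
  measurable_fun setT (fun x => f x * (g x)^*).
Proof.
move=> /measurable_complexP[fr fi] /measurable_complexP[gr gi].
apply/measurable_complexP; split.
- rewrite (_ : _ \o _ = (fun x => complex.Re (f x) * complex.Re (g x) + complex.Im (f x) * complex.Im (g x))).
    by apply: measurable_funD; apply: measurable_funM.
  by apply/funext => x /=; case: (f x) (g x) => ? ? [? ?] /=; ring.
- rewrite (_ : _ \o _ = (fun x => complex.Im (f x) * complex.Re (g x) - complex.Re (f x) * complex.Im (g x))).
    by apply: measurable_funB; apply: measurable_funM.
  by apply/funext => x /=; case: (f x) (g x) => ? ? [? ?] /=; ring.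
Qed.

Lemma cintegrable_mul_conj (f g : L2fun mu) : cintegrable (fun x => f x * (g x)^*).
Proof.
have [mr mi] := (measurable_complexP _).1
  (measurable_mul_conj (L2fun_measurable f) (L2fun_measurable g)).
have ifg := integrableD measurableT (L2fun_integrable f) (L2fun_integrable g).
have sq (u v p q : R) : `|u * p + v * q| <= `|u ^+ 2 + v ^+ 2 + (p ^+ 2 + q ^+ 2)|.
  rewrite [leRHS]ger0_norm ?addr_ge0 ?sqr_ge0//.
  have := (sqr_ge0 (u - p), sqr_ge0 (u + p), sqr_ge0 (v - q), sqr_ge0 (v + q)).
  have := (sqr_ge0 u, sqr_ge0 v, sqr_ge0 p, sqr_ge0 q).
  by move=> [[[? ?] ?] ?] [[[? ?] ?] ?]; rewrite ler_norml; apply/andP; split; nra.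
split; apply: (le_integrable measurableT _ _ ifg); try exact/measurable_EFinP.
- move=> x _; rewrite /= lee_fin /sqnorm; case: (f x) (g x) => a b [c e] /=.
  by rewrite -mulrN opprK; exact: sq.
- move=> x _; rewrite /= lee_fin /sqnorm; case: (f x) (g x) => a b [c e] /=.
  by apply: le_trans (sq _ _ _ _) _; rewrite sqrrN [e ^+ 2 + _]addrC.
Qed.

Local Notation dot := L2dot.

Lemma L2dotZD G : scalar (dot^~ G).
Proof.
move=> a F F'; rewrite /L2dot.
rewrite -cintegralZD; try exact: cintegrable_mul_conj.
apply: ae_eq_cintegral.
- by apply: measurable_mul_conj; exact: L2fun_measurable.
- apply: (@measurable_complexD _ _ _ (fun x => a * _)); last exact: measurable_mul_conj (L2fun_measurable _) (L2fun_measurable _).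
  apply: measurable_complex_scale; exact: measurable_mul_conj (L2fun_measurable _) (L2fun_measurable _).
have : {ae mu, forall x, repr (a *: F + F') x = a * repr F x + repr F' x}.
  apply/(@L2_eqP _ _ _ _ _ (a *: repr F + repr F')).
  by rewrite reprK pi_L2D -pi_scale !reprK.
by apply: filterS => x ->; rewrite mulrDl mulrA.
Qed.

Lemma L2dotC F G : dot F G = (dot G F)^*.
Proof.
rewrite /L2dot -cintegral_conj; last exact: cintegrable_mul_conj.
congr cintegral; apply/funext => x; rewrite rmorphM/= conjcK mulrC.
by [].
Qed.

Lemma L2dot_gt0 F : F != 0 -> 0 < dot F F.
Proof.
have E x : repr F x * (repr F x)^* = (sqnorm (repr F x))%:C.
  by case: (repr F x) => a b; simpc; rewrite /sqnorm/=; congr (_ +i* _); ring.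
have dotE : dot F F = (\int[mu]_x sqnorm (repr F x))%:C.
  by rewrite /L2dot; under eq_fun do rewrite E; rewrite cintegralE/= Rintegral_cst// mul0r.
rewrite dotE ltcR => F0; rewrite lt_neqAle Rintegral_ge0; last by move=> *; exact: sqnorm_ge0.
rewrite andbT eq_sym; apply: contra F0 => /eqP I0.
suff FE : \pi_(L2 mu) (repr F) = \pi_(L2 mu) (0 *: repr F).
  by rewrite -[F]reprK FE -pi_scale; apply/eqP; exact: scale0r.
rewrite scale0r; apply/L2_eqP.
have : (\int[mu]_x `|(sqnorm (repr F x))%:E| = 0)%E.
  rewrite (eq_integral (fun x => (sqnorm (repr F x))%:E)).
    rewrite -[LHS]fineK; first by rewrite -/(Rintegral _ _ _) I0.
    exact: integrable_fin_num (L2fun_integrable _).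
  by move=> x _; rewrite gee0_abs// lee_fin sqnorm_ge0.
move/ae_eq_integral_abs => /(_ measurableT) h.
have {}h := h (proj1 (integrableP _ _ _ (L2fun_integrable (repr F)))).
apply: filterS h => x /(_ I) [] /eqP.
rewrite /sqnorm paddr_eq0 ?sqr_ge0// !sqrf_eq0 => /andP[/eqP r0 /eqP i0].
by apply/eqP; rewrite eq_complex r0 i0 !eqxx.
Qed.

Lemma L2dot_bilinear : bilinear_for *%R (Num.conj \; *%R) dot.
Proof.
split=> [G|F]; first exact: L2dotZD.
by move=> a G G'; rewrite L2dotC L2dotZD rmorphD rmorphM/= [dot F G]L2dotC [dot F G']L2dotC.
Qed.

HB.instance Definition _ := bilinear_isBilinear.Build R[i] (L2 mu) (L2 mu) R[i]
  *%R (Num.conj \; *%R) dot L2dot_bilinear.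
Lemma L2dot_herm F G : dot F G = (-1) ^+ false * Num.conj (dot G F).
Proof. by rewrite expr0 mul1r L2dotC. Qed.
HB.instance Definition _ := isHermitianSesquilinear.Build R[i] (L2 mu) false Num.conj dot L2dot_herm.
HB.instance Definition _ := isDotProduct.Build R[i] (L2 mu) dot L2dot_gt0.
End dot.
Arguments L2dot {d X R} mu F G.

Section operators.
Context (R : realType) (H : lmodType R[i]) (ip : {dot H for Num.conj}).

Definition hnorm (x : H) : R := Num.sqrt (complex.Re (ip x x)).

Definition hcvg (u : nat -> H) (x : H) : Prop :=
  hnorm (u n - x) @[n --> \oo] --> (0 : R).

Definition hdense (D : set H) : Prop :=
  forall (x : H) (e : R), 0 < e -> exists2 y, D y & hnorm (x - y) < e.

(* The values of [op_fun] outside [dom] are irrelevant: every definition below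
   only looks at [op_fun x] for [x] in [dom]. *)
Record operator := Operator { dom : set H ; op_fun :> H -> H }.

Definition linear_operator (T : operator) : Prop :=
  dom T 0 /\ forall (a : R[i]) x y, dom T x -> dom T y ->
    dom T (a *: x + y) /\ T (a *: x + y) = a *: T x + T y.

Definition closed_operator (T : operator) : Prop :=
  forall (u : nat -> H) x y, (forall n, dom T (u n)) ->
    hcvg u x -> hcvg (fun n => T (u n)) y -> dom T x /\ T x = y.

Definition op_comp (S T : operator) : operator :=
  Operator [set x | dom T x /\ dom S (T x)] (fun x => S (T x)).

Definition op_pow (T : operator) (n : nat) : operator :=
  iter n (op_comp T) (Operator setT id).

Definition adjoint_graph (T : operator) (y z : H) : Prop :=
  forall x, dom T x -> ip (T x) y = ip x z.

(* For densely defined [T] at most one [z] satisfies [adjoint_graph T y z]. *)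
Definition adjoint (T : operator) : operator :=
  Operator [set y | exists z, adjoint_graph T y z]
           (fun y => xget 0 (adjoint_graph T y)).

Definition orthogonal_projection (P : H -> H) : Prop :=
  [/\ linear P, forall x, P (P x) = P x & forall x y, ip (P x) y = ip x (P y)].

Definition projection_valued_measure (E : set R[i] -> H -> H) : Prop :=
  [/\ forall s, measurable s -> orthogonal_projection (E s),
      forall x, E setT x = x
    & forall (F : nat -> set R[i]) x,
        (forall n, measurable (F n)) -> trivIset setT F ->
        hcvg (fun n => \sum_(i < n) E (F i) x) (E (\bigcup_n F n) x)].

Definition scalar_measure (E : set R[i] -> H -> H) (x : H) : set R[i] -> \bar R :=
  fun s => (complex.Re (ip (E s x) x))%:E.

(* [A] is the integral of the identity function against [E]. It is determined
   by its quadratic form on its domain: polarization gives [<A x, y>] for [x],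
   [y] in the domain, which is dense. *)
Definition spectral_measure_of (A : operator) (E : set R[i] -> H -> H) : Prop :=
  [/\ projection_valued_measure E,
      dom A = [set x | (\int[scalar_measure E x]_z (sqnorm z)%:E < +oo)%E]
    & forall x, dom A x -> ip (A x) x = cintegral (scalar_measure E x) id].

(* The spectral measures [E n] are bound existentially; by the spectral theorem
   each of them is unique on Borel sets. *)
Definition spectrally_half_centered (T : operator) : Prop :=
  [/\ linear_operator T,
      forall n, (0 < n)%N ->
        hdense (dom (op_pow T n)) /\ closed_operator (op_pow T n)
    & exists E : nat -> set R[i] -> H -> H,
        (forall n, (0 < n)%N ->
          spectral_measure_of
            (op_comp (adjoint (op_pow T n)) (op_pow T n)) (E n)) /\
        (forall n m, (0 < n)%N -> (0 < m)%N ->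
          forall s t : set R[i], measurable s -> measurable t ->
          forall x, E n s (E m t x) = E m t (E n s x))].

End operators.

Section weighted_composition.
Context d (X : measurableType d) (R : realType) (mu : {measure set X -> \bar R}).
Variables (phi : X -> X) (w : X -> R[i]).
Local Open Scope quotient_scope.

Definition weighted_measure (s : set X) : \bar R :=
  (\int[mu]_(x in s) (sqnorm (w x))%:E)%E.

Definition wcomp_well_defined : Prop :=
  (fun s => weighted_measure (phi @^-1` s)) `<< mu.

(* The class of [f]; it is [0] when [f] is not square-integrable. *)
Definition L2_class (f : X -> R[i]) : L2 mu := \pi_(L2 mu) (insubd 0 f).

(* Stated on the chosen representative of [F]; independent of that choice when
   [wcomp_well_defined] holds. *)
Definition wcomp : operator (L2 mu) :=
  Operator
    [set F : L2 mu | square_integrable mu (fun x => w x * repr F (phi x))]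
    (fun F => L2_class (fun x => w x * repr F (phi x))).

End weighted_composition.

(* Main.v *)
Require Import Defs.
From HB Require Import structures.
From mathcomp Require Import all_boot all_order all_algebra.
From mathcomp Require Import complex.
From mathcomp Require Import all_classical all_reals all_analysis.
From mathcomp Require Import measurable_realfun ring lra.
Import Order.TTheory GRing.Theory Num.Theory.
Import numFieldNormedType.Exports.
Local Open Scope classical_set_scope.
Local Open Scope ring_scope.

(** Write [T] for the weighted composition operator and [w_n] for the product of
    the [w \o phi^k], [k < n], so that [T^n F = w_n (F \o phi^n)].  The idea is that
    every product of the adjoint of [T^n] with [T^n] is an operator of
    multiplication by a function [h_n], and multiplication operators commute.

    The function [h_n] is the Radon-Nikodym derivative with respect to [mu] of the
    image [nu_n] of [|w_n|^2 mu] under [phi^n]; then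
    [<T^n F, T^n G> = \int h_n F conj(G)].  Absolute continuity follows from
    well-definedness ([power_measure_dominated]).  The measure [nu_n] need not be
    finite, but each [F] in the dense common domain of the powers has
    [\int |F|^2 d nu_n < oo], so that countably many sets of finite [nu_n]-measure cover
    almost everything ([dense_exhaustion]); this suffices for a density with finite
    values ([radon_nikodym_exhaustion]).

    A priori [F] is in the domain of [T^n] when [\int h_k |F|^2] is finite for all
    [k <= n].  Closedness of [T^n] reduces this to the single condition
    [k = n] ([op_pow_dom_closed]), so that [T^n] has the form [\int h_n F conj(G)] on its
    maximal domain.  For an operator with such a form, testing against truncated
    functions shows that the adjoint of [T^n] sends [T^n F] to [h_n F], and that the
    product is multiplication by [h_n] on its maximal domain
    ([spectral_measure_weighted_form]).  Its spectral measure sends [s] to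
    multiplication by the indicator of the set where [h_n] lies in [s]. *)

Set Implicit Arguments. Unset Strict Implicit. Unset Printing Implicit Defensive.
Local Open Scope complex_scope.

(** * Integration against images of densities *)

Section transfer.
Context (R : realType).
Import HBNNSimple.

(** An integral only evaluates its set function on the level sets of measurable
    simple functions.  This is what gives access to integrals against a bare
    set function such as [scalar_measure], whose values on non-measurable sets
    are arbitrary. *)
Lemma eq_integral_setfun d (T : measurableType d) (nu1 nu2 : set T -> \bar R)
    (f : T -> \bar R) :
  (forall A, measurable A -> nu1 A = nu2 A) ->
  (\int[nu1]_x f x = \int[nu2]_x f x)%E.
Proof.
move=> nu12; rewrite /integral.
by congr (ereal_sup _ - ereal_sup _)%E; apply: eq_imagel => h _;
  apply: eq_fsbigr => r _; rewrite nu12.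
Qed.

Section density.
Context d (X : measurableType d) (mu : {measure set X -> \bar R}).

Definition density (v : X -> R) (A : set X) : \bar R :=
  (\int[mu]_(x in A) (v x)%:E)%E.

Variable v : X -> R.
Hypotheses (mv : measurable_fun setT v) (v0 : forall x, 0 <= v x).

Lemma density_is_measure :
  exists m : {measure set X -> \bar R}, (m : set X -> \bar R) = density v.
Proof.
have d0 : density v set0 = 0%E by rewrite /density integral_set0.
have dge A : (0 <= density v A)%E.
  by apply: integral_ge0 => x _; rewrite lee_fin.
have ds : semi_sigma_additive (density v).
  by apply: semi_sigma_additive_nng_induced => //; exact/measurable_EFinP.
pose mix := isMeasure.Build _ _ _ (density v) d0 dge ds.
pose m : {measure set X -> \bar R} := HB.pack (density v) mix.
by exists m.
Qed.

(** Both sides are monotone limits along simple functions increasing to [f], and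
    on an indicator function the identity is the definition of a density. *)
Lemma integral_density (m : {measure set X -> \bar R}) (f : X -> \bar R) :
  (forall A, measurable A -> m A = density v A) ->
  measurable_fun setT f -> (forall x, 0 <= f x)%E ->
  (\int[m]_x f x = \int[mu]_x ((v x)%:E * f x))%E.
Proof.
move=> mE mf f0.
pose h := nnsfun_approx measurableT mf.
have hf x : (EFin \o h n) x @[n --> \oo] --> f x.
  by apply: cvg_nnsfun_approx.
have hnd x : {homo (fun n => (h n x)%:E) : a b / (a <= b)%N >-> (a <= b)%E}.
  by move=> a b ab; rewrite lee_fin; exact/lefP/nd_nnsfun_approx.
have mh n : measurable_fun setT (EFin \o h n).
  by apply/measurable_EFinP.
have mvE : measurable_fun setT (EFin \o v) by exact/measurable_EFinP.
transitivity (limn (fun n => \int[m]_x (h n x)%:E)%E).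
  rewrite -monotone_convergence//=; last by move=> n x _; rewrite lee_fin.
  by apply: eq_integral => x _; apply/esym/cvg_lim => //; exact: hf.
transitivity (limn (fun n => \int[mu]_x ((v x)%:E * (h n x)%:E))%E); last first.
  rewrite -monotone_convergence//=.
  - by apply: eq_integral => x _; apply: cvg_lim => //; apply: cvgeZl; [|exact: hf].
  - by move=> n; apply: emeasurable_funM; [exact: mvE|exact: mh].
  - by move=> n x _; rewrite mule_ge0 ?lee_fin.
  - by move=> x _ a b ab; rewrite lee_wpmul2l ?lee_fin//; exact/lefP/nd_nnsfun_approx.
congr (limn _); apply/funext => n.
have mind r : measurable (h n @^-1` [set r]) by [].
transitivity (\int[m]_x (\sum_(r \in range (h n))
    (r * \1_(h n @^-1` [set r]) x)%:E))%E.
  by apply: eq_integral => x _; rewrite /= fimfunE -fsumEFin.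
rewrite ge0_integral_fsum//; last 2 first.
  - by move=> r; apply/measurable_EFinP; exact: measurable_funM.
  - by move=> r x _; exact: nnfun_muleindic_ge0.
transitivity (\int[mu]_x (\sum_(r \in range (h n))
    ((v x)%:E * (r * \1_(h n @^-1` [set r]) x)%:E)))%E; last first.
  apply: eq_integral => x _; rewrite [in RHS]fimfunE -fsumEFin//.
  by rewrite ge0_mule_fsumr// => r; exact: nnfun_muleindic_ge0.
rewrite ge0_integral_fsum//; last 2 first.
  - move=> r; apply: emeasurable_funM => //.
    by apply/measurable_EFinP; exact: measurable_funM.
  - by move=> r x _; rewrite mule_ge0 ?lee_fin//; exact: nnfun_muleindic_ge0.
apply: eq_fsbigr => r rhn.
rewrite integralZl_indic_nnsfun// integral_indic// setIT.
have r0 : 0 <= r by move: rhn; rewrite inE => -[t _ <-].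
transitivity (r%:E * \int[mu]_x ((v x)%:E * (\1_(h n @^-1` [set r]) x)%:E))%E; last first.
  rewrite -ge0_integralZl//.
  - by apply: eq_integral => x _; rewrite EFinM muleCA.
  - by apply: emeasurable_funM => //; exact/measurable_EFinP.
  - by move=> x _; rewrite mule_ge0 ?lee_fin.
rewrite mE// /density integral_mkcond; congr (_ * _)%E.
by apply: eq_integral => x _; rewrite epatch_indic.
Qed.

Context d' (Y : measurableType d') (psi : X -> Y) (nu : set Y -> \bar R).
Hypotheses (mpsi : measurable_fun setT psi)
  (nuE : forall s, measurable s -> nu s = density v (psi @^-1` s)).

Lemma image_density_is_measure : exists m : {measure set Y -> \bar R},
  forall s, measurable s -> nu s = m s.
Proof.
have [m mE] := density_is_measure.
unshelve eexists (pushforward m psi : {measure set Y -> \bar R}) => // s ms.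
by rewrite nuE// /pushforward/= mE.
Qed.

Lemma ge0_integral_image_density (g : Y -> \bar R) :
  measurable_fun setT g -> (forall y, 0 <= g y)%E ->
  (\int[nu]_y g y = \int[mu]_x ((v x)%:E * g (psi x)))%E.
Proof.
move=> mg g0; have [m mE] := density_is_measure.
transitivity (\int[pushforward m psi]_y g y)%E.
  by apply: eq_integral_setfun => s ms; rewrite nuE// /pushforward/= mE.
rewrite (ge0_integral_pushforward mpsi)//= (integral_density (f := g \o psi))//.
- by move=> A _; rewrite mE.
- exact: measurableT_comp.
- by move=> x; exact: g0.
Qed.

(** No integrability is required: multiplication by [v >= 0] commutes with taking
    positive and negative parts, and the integral of a signed function is by
    definition the difference of the integrals of its two parts. *)
Lemma integral_image_density (g : Y -> R) : measurable_fun setT g ->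
  (\int[nu]_y (g y)%:E = \int[mu]_x (v x * g (psi x))%:E)%E.
Proof.
move=> mg; have [m mE] := image_density_is_measure.
have mgE : measurable_fun setT (EFin \o g) by exact/measurable_EFinP.
rewrite (eq_integral_setfun _ mE) integralE [RHS]integralE.
congr (_ - _)%E; rewrite -(eq_integral_setfun _ mE) ge0_integral_image_density//.
- apply: eq_integral => x _; rewrite !funeposE.
  by rewrite EFinM /= maxe_pMr ?mule0 ?lee_fin.
- exact: measurable_funepos.
- apply: eq_integral => x _; rewrite !funenegE.
  by rewrite [in RHS]EFinM -muleN maxe_pMr ?mule0 ?lee_fin.
- exact: measurable_funeneg.
Qed.

Lemma cintegral_image_density (g : Y -> R[i]) : measurable_fun setT g ->
  cintegral nu g = cintegral mu (fun x => (v x)%:C * g (psi x)).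
Proof.
move=> /measurable_complexP[mr mi].
congr (fine _ +i* fine _); rewrite integral_image_density//.
  by apply: eq_integral => x _; case: (g (psi x)) => a b /=; rewrite mul0r subr0.
by apply: eq_integral => x _; case: (g (psi x)) => a b /=; rewrite mul0r addr0.
Qed.
End density.
End transfer.

(** * Radon-Nikodym derivatives of measures with finite exhaustions *)

Section radon_nikodym.
Context (R : realType) d (X : measurableType d).
Variables (mu : {sigma_finite_measure set X -> \bar R})
  (nu : {measure set X -> \bar R}).
Hypothesis numu : nu `<< mu.

(** Radon-Nikodym for a dominated measure [nu] that need not be finite: on the
    disjoint pieces cut out by the [A n] the measure [nu] is finite, so the finite
    theorem applies, and the densities add up to a density of [nu]; what the [A n]
    leave uncovered is null for [mu], hence for [nu].  The sum has a finite
    integral over each piece, so it is finite almost everywhere and can be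
    replaced by a real function. *)
Lemma radon_nikodym_exhaustion (A : nat -> set X) :
  (forall n, measurable (A n)) -> (forall n, nu (A n) < +oo)%E ->
  mu (~` \bigcup_n A n) = 0%E ->
  exists h : X -> R, [/\ measurable_fun setT h, forall x, 0 <= h x &
    forall s, measurable s -> nu s = density mu h s].
Proof.
move=> mA nuA muA; pose E := seqDU A.
have mE k : measurable (E k).
  by apply: measurableD => //; exact: bigsetU_measurable.
have nuE k : (nu (E k) < +oo)%E.
  by rewrite (le_lt_trans _ (nuA k))// le_measure ?inE//; exact: subDsetl.
have UE : \bigcup_i E i = \bigcup_i A i by rewrite -seqDU_bigcup_eq.
have mUE : measurable (\bigcup_i E i) by exact: bigcupT_measurable.
have tE : trivIset setT E := @trivIset_seqDU _ A.
pose nu_ j : {finite_measure set X -> \bar R} := mfrestr (mE j) (nuE j).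
have nu_mu j : nu_ j `<< mu.
  apply/null_content_dominatesP => S mS muS0.
  have /null_content_dominatesP dom := numu.
  rewrite /nu_ /= /mfrestr /mrestr; apply/eqP; rewrite eq_le measure_ge0 andbT.
  by rewrite -(dom S mS muS0); apply: le_measure; rewrite ?inE//; exact: measurableI.
have [f_ /all_and4[f0 ffin fint fE]] :=
  choice (fun j => radon_nikodym_sigma_finite (nu_mu j)).
have mf_ j : measurable_fun setT (f_ j) by have /integrableP[] := fint j.
pose f x : \bar R := (\sum_(j <oo) f_ j x)%E.
have fge0 x : (0 <= f x)%E by apply: nneseries_ge0.
have mf : measurable_fun setT f by exact: ge0_emeasurable_sum.
have nuf s : measurable s -> nu s = (\int[mu]_(x in s) f x)%E.
  move=> ms; rewrite integral_nneseries//; last first.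
    by move=> n; exact: measurable_funTS.
  have -> : nu s = nu (s `&` \bigcup_i E i).
    have mI := measurableI _ _ ms mUE.
    rewrite -[in LHS](setUIDK s (\bigcup_i E i)) measureU//.
    - rewrite [X in (_ + X)%E](_ : _ = 0%E) ?adde0//.
      have /null_content_dominatesP dom := numu.
      apply: (@subset_measure0 _ _ _ nu _ (~` \bigcup_i E i)) => //.
      + exact: measurableD.
      + exact: measurableC.
      + by apply: dom; [exact: measurableC|rewrite UE].
    - exact: measurableD.
    - by rewrite setDE setIACA setICr setI0.
  rewrite setI_bigcupr measure_bigcup//; first last.
  - exact: trivIset_setIl.
  - by move=> i _; exact: measurableI.
  rewrite (@eq_eseriesl _ _ xpredT); last first.
    by move=> x; rewrite in_setT.
  by apply: eq_eseriesr => i _; rewrite -fE.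
have ffin_ae : {ae mu, forall x, f x \is a fin_num}.
  have fiA j : {ae mu, forall x, E j x -> f x \is a fin_num}.
    apply: integrable_ae => //; apply/integrableP; split.
      exact: measurable_funTS.
    by under eq_integral do rewrite gee0_abs//; rewrite -nuf.
  have : {ae mu, forall x, ~ (~` \bigcup_i E i) x}.
    exists (~` \bigcup_i E i); split; [exact: measurableC|by rewrite UE|].
    by move=> x /= /contrapT.
  have : {ae mu, forall x, forall j, E j x -> f x \is a fin_num}.
    exact: ae_foralln.
  by apply: filterS2 => x fx /contrapT [j _ Ej]; exact: (fx j).
exists (fine \o f); split.
- exact: measurableT_comp.
- by move=> x; exact: fine_ge0.
move=> s ms; rewrite nuf// /density; apply: ae_eq_integral => //.
- exact: measurable_funTS.
- by apply: measurable_funTS; apply/measurable_EFinP; exact: measurableT_comp.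
- by apply: filterS ffin_ae => x fx _; rewrite /= fineK.
Qed.
End radon_nikodym.

(** * Representatives of square-integrable classes *)

Section L2_representatives.
Context (R : realType) d (X : measurableType d) (mu : {measure set X -> \bar R}).
Implicit Types (f g : X -> R[i]) (F G : L2 mu).
Local Open Scope quotient_scope.

Lemma L2_ext F G : {ae mu, forall x, repr F x = repr G x} -> F = G.
Proof. by move=> FG; rewrite -[F]reprK -[G]reprK; apply/L2_eqP. Qed.

Lemma repr_square_integrable F : square_integrable mu (repr F).
Proof. by case: (repr F) => f /= /asboolP. Qed.

Lemma measurable_repr F : measurable_fun setT (repr F).
Proof. exact: L2fun_measurable. Qed.

Lemma integral_sqnorm_ae f g : measurable_fun setT f -> measurable_fun setT g ->
  {ae mu, forall x, f x = g x} ->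
  (\int[mu]_x (sqnorm (f x))%:E = \int[mu]_x (sqnorm (g x))%:E)%E.
Proof.
move=> mf mg fg; apply: ae_eq_integral => //.
- by apply/measurable_EFinP; exact: measurable_sqnorm.
- by apply/measurable_EFinP; exact: measurable_sqnorm.
- by apply: filterS fg => x ->.
Qed.

Lemma square_integrable_ae f g : measurable_fun setT g ->
  {ae mu, forall x, f x = g x} -> square_integrable mu f -> square_integrable mu g.
Proof. by move=> mg fg [mf fi]; split => //; rewrite -(integral_sqnorm_ae mf mg fg). Qed.

Lemma repr_L2_class f : square_integrable mu f ->
  {ae mu, forall x, repr (L2_class mu f) x = f x}.
Proof.
move=> fi; have fP : f \in sqint mu by apply/asboolP.
have : {ae mu, forall x, repr (\pi_(L2 mu) (insubd (0 : L2fun mu) f)) x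
    = insubd (0 : L2fun mu) f x} by exact: L2_reprE.
apply: filterS => x; rewrite /L2_class => ->.
exact: (congr1 (fun k : X -> R[i] => k x) (insubdK (0 : L2fun mu) fP)).
Qed.

Lemma L2_class_repr F f : measurable_fun setT f ->
  {ae mu, forall x, repr F x = f x} -> L2_class mu f = F.
Proof.
move=> mf Ff; apply: L2_ext.
have fi : square_integrable mu f.
  exact: square_integrable_ae Ff (repr_square_integrable F).
by apply: filterS2 Ff (repr_L2_class fi) => x -> ->.
Qed.

Lemma repr_linear a F G :
  {ae mu, forall x, repr (a *: F + G) x = a * repr F x + repr G x}.
Proof.
apply/(@L2_eqP _ _ _ _ _ (a *: repr F + repr G)).
by rewrite reprK pi_L2D -pi_scale !reprK.
Qed.

Lemma repr0 : {ae mu, forall x, repr (0 : L2 mu) x = 0}.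
Proof.
have := repr_linear (-1) 0 0; rewrite scaler0 addr0.
by apply: filterS => x {1}->; rewrite mulN1r addNr.
Qed.

Lemma repr_sub F G : {ae mu, forall x, repr (F - G) x = repr F x - repr G x}.
Proof.
have := repr_linear (-1) G F; rewrite scaleN1r addrC.
by apply: filterS => x ->; rewrite mulN1r addrC.
Qed.

Lemma repr_sum (I : Type) (s : seq I) (F : I -> L2 mu) :
  {ae mu, forall x, repr (\sum_(i <- s) F i) x = \sum_(i <- s) repr (F i) x}.
Proof.
elim: s => [|i s IHs].
  by apply: filterS repr0 => x; rewrite !big_nil.
have := repr_linear 1 (F i) (\sum_(i <- s) F i).
by apply: filterS2 IHs => x sx; rewrite !big_cons scale1r => ->; rewrite sx mul1r.
Qed.

Lemma L2dot_ae F G f g : measurable_fun setT f -> measurable_fun setT g ->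
  {ae mu, forall x, repr F x = f x} -> {ae mu, forall x, repr G x = g x} ->
  L2dot mu F G = cintegral mu (fun x => f x * Num.conj (g x)).
Proof.
move=> mf mg Ff Gg; apply: ae_eq_cintegral.
- by apply: measurable_mul_conj; exact: measurable_repr.
- exact: measurable_mul_conj.
- by apply: filterS2 Ff Gg => x -> ->.
Qed.

Lemma mul_conjC (z : R[i]) : z * Num.conj z = (sqnorm z)%:C.
Proof. by case: z => a b; simpc; rewrite /sqnorm/=; congr (_ +i* _); ring. Qed.

Lemma sqnorm_real (a : R) : sqnorm a%:C = a ^+ 2.
Proof. by rewrite /sqnorm/= expr0n addr0. Qed.

Lemma hnormE F f : measurable_fun setT f -> {ae mu, forall x, repr F x = f x} ->
  hnorm (L2dot mu) F = Num.sqrt (fine (\int[mu]_x (sqnorm (f x))%:E)).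
Proof.
move=> mf Ff; rewrite /hnorm -[X in complex.Re X]/(L2dot mu F F) (L2dot_ae mf mf Ff Ff).
by congr (Num.sqrt (fine _)); apply: eq_integral => x _; rewrite mul_conjC.
Qed.

Lemma integral_dominated_cvg0 (k : X -> R) (c : nat -> X -> R) :
  mu.-integrable setT (EFin \o k) -> (forall x, 0 <= k x) ->
  (forall n, measurable_fun setT (c n)) -> (forall n x, `|c n x| <= 1) ->
  (forall x, c n x @[n --> \oo] --> (0 : R)) ->
  (\int[mu]_x (c n x ^+ 2 * k x)%:E @[n --> \oo] --> 0)%E.
Proof.
move=> ki k0 mc c1 c0.
have mk : measurable_fun setT k by case/integrableP : ki => /measurable_EFinP.
have [] := @dominated_convergence _ X R mu setT measurableT
  (fun n x => (c n x ^+ 2 * k x)%:E) (cst 0%E) (EFin \o k).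
- move=> n; apply/measurable_EFinP; apply: measurable_funM => //.
  exact: measurable_funX.
- exact: measurable_cst.
- apply: aeW => x _; apply: cvg_EFin; first exact: nearW.
  have := cvgM (cvgM (c0 x) (c0 x)) (@cvg_cst _ (k x) _ \oo _).
  by rewrite !mul0r; apply.
- exact: ki.
- apply: aeW => x n _; rewrite /= lee_fin normrM normrX (ger0_norm (k0 x)).
  by rewrite ler_piMl// exprn_ile1.
by move=> _ _; rewrite integral0.
Qed.

(** The form in which dominated convergence is used: [c n ^+ 2 * k] is the density
    of the squared norm of the error of the [n]-th approximation, where [c n] is a
    truncation error tending to [0] pointwise and [k] an integrable density. *)
Lemma hcvg_dominated (u : nat -> L2 mu) F (k : X -> R) (c : nat -> X -> R) :
  mu.-integrable setT (EFin \o k) -> (forall x, 0 <= k x) ->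
  (forall n, measurable_fun setT (c n)) -> (forall n x, `|c n x| <= 1) ->
  (forall x, c n x @[n --> \oo] --> (0 : R)) ->
  (forall n, \int[mu]_x (sqnorm (repr (u n - F) x))%:E =
    \int[mu]_x (c n x ^+ 2 * k x)%:E)%E ->
  hcvg (L2dot mu) u F.
Proof.
move=> ki k0 mc c1 c0 uE; rewrite /hcvg.
under eq_fun do rewrite (hnormE (measurable_repr _) (aeW _ (fun x => erefl))) uE.
have sI : fine (\int[mu]_x (c n x ^+ 2 * k x)%:E)%E @[n --> \oo] --> (0 : R).
  by apply: fine_cvg; exact: integral_dominated_cvg0.
have := cvg_comp _ _ sI (@sqrt_continuous R 0).
by rewrite sqrtr0.
Qed.

End L2_representatives.

(** * Multiplication operators *)

(** Locked, so that comparing two almost-everywhere statements about products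
    does not unfold the quotient construction of [L2]. *)
HB.lock Definition mulop (R : realType) d (X : measurableType d)
    (mu : {measure set X -> \bar R}) (b : X -> R) (F : L2 mu) : L2 mu :=
  L2_class mu (fun x => (b x)%:C * repr F x).

Section multiplication_operator.
Context (R : realType) d (X : measurableType d) (mu : {measure set X -> \bar R}).
Implicit Types (f g : X -> R[i]) (F G : L2 mu) (b : X -> R).

Lemma measurable_RtoC b : measurable_fun setT b ->
  measurable_fun setT (fun x => (b x)%:C).
Proof.
by move=> mb; apply/measurable_complexP; split; [exact: mb|exact: measurable_cst].
Qed.

Lemma measurable_complexM (f g : X -> R[i]) : measurable_fun setT f ->
  measurable_fun setT g -> measurable_fun setT (fun x => f x * g x).
Proof.
move=> /measurable_complexP[fr fi] /measurable_complexP[gr gi].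
apply/measurable_complexP; split.
- rewrite (_ : _ \o _ = (fun x =>
      complex.Re (f x) * complex.Re (g x) - complex.Im (f x) * complex.Im (g x))).
    by apply: measurable_funB; apply: measurable_funM.
  by apply/funext => x /=; case: (f x) (g x) => ? ? [? ?].
- rewrite (_ : _ \o _ = (fun x =>
      complex.Re (f x) * complex.Im (g x) + complex.Im (f x) * complex.Re (g x))).
    by apply: measurable_funD; apply: measurable_funM.
  by apply/funext => x /=; case: (f x) (g x) => ? ? [? ?].
Qed.

Lemma measurable_realmul b f : measurable_fun setT b -> measurable_fun setT f ->
  measurable_fun setT (fun x => (b x)%:C * f x).
Proof.
move=> mb /measurable_complexP[mr mi]; apply/measurable_complexP; split.
- rewrite (_ : _ \o _ = (fun x => b x * complex.Re (f x))).
    exact: measurable_funM.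
  by apply/funext => x /=; case: (f x) => p q /=; rewrite mul0r subr0.
- rewrite (_ : _ \o _ = (fun x => b x * complex.Im (f x))).
    exact: measurable_funM.
  by apply/funext => x /=; case: (f x) => p q /=; rewrite mul0r addr0.
Qed.

Lemma sqnorm_realmul (a : R) (z : R[i]) : sqnorm (a%:C * z) = a ^+ 2 * sqnorm z.
Proof. by rewrite sqnormM sqnorm_real. Qed.

Lemma conjC_realmul (a : R) (z : R[i]) :
  Num.conj (a%:C * z) = a%:C * Num.conj z.
Proof. by rewrite rmorphM/=; exact: (congr1 (fun t => t * _) (conjc_real a)). Qed.

Lemma square_integrable_realmul b (c : R) f : measurable_fun setT b ->
  (forall x, `|b x| <= c) -> square_integrable mu f ->
  square_integrable mu (fun x => (b x)%:C * f x).
Proof.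
move=> mb bc [mf fi]; have mbf := measurable_realmul mb mf; split => //.
have msf : measurable_fun setT (fun x => (sqnorm (f x))%:E).
  by apply/measurable_EFinP; exact: measurable_sqnorm.
apply: (@le_lt_trans _ _ (\int[mu]_x ((c ^+ 2)%:E * (sqnorm (f x))%:E))%E).
  apply: ge0_le_integral => //=.
  - by move=> x _; rewrite lee_fin sqnorm_ge0.
  - by apply/measurable_EFinP; exact: measurable_sqnorm.
  - exact: measurable_funeM.
  - move=> x _; rewrite -EFinM lee_fin sqnorm_realmul ler_wpM2r ?sqnorm_ge0//.
    by rewrite -[leLHS]real_normK ?num_real// lerXn2r ?nnegrE// (le_trans _ (bc x)).
rewrite ge0_integralZl//; last 2 first.
  by move=> x _; rewrite lee_fin sqnorm_ge0.
  by rewrite lee_fin sqr_ge0.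
by rewrite lte_mul_pinfty// lee_fin sqr_ge0.
Qed.

Lemma repr_mulop b (c : R) F : measurable_fun setT b -> (forall x, `|b x| <= c) ->
  {ae mu, forall x, repr (mulop b F) x = (b x)%:C * repr F x}.
Proof.
move=> mb bc; rewrite mulop.unlock; apply: repr_L2_class.
exact: square_integrable_realmul mb bc (repr_square_integrable F).
Qed.

Lemma normr_indic (A : set X) x : `|\1_A x : R| <= 1.
Proof. by rewrite indicE; case: (_ \in _); rewrite /= ?normr1 ?normr0 ?ler01. Qed.

Lemma repr_mulop_indic (A : set X) F : measurable A ->
  {ae mu, forall x, repr (mulop \1_A F) x = (\1_A x)%:C * repr F x}.
Proof. by move=> mA; apply: repr_mulop (@normr_indic A); exact: measurable_indic. Qed.

Lemma mulop_indic_projection (A : set X) : measurable A ->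
  orthogonal_projection (L2dot mu) (mulop \1_A).
Proof.
move=> mA; have mI : measurable_fun setT (\1_A : X -> R) by exact: measurable_indic.
split=> [a F G|F|F G].
- apply: L2_ext.
  apply: filter_app (repr_linear a F G).
  apply: filter_app (repr_mulop_indic F mA).
  apply: filter_app (repr_mulop_indic G mA).
  apply: filter_app (repr_linear a (mulop \1_A F) (mulop \1_A G)).
  apply: filterS (repr_mulop_indic (a *: F + G) mA) => x -> -> -> -> ->.
  by rewrite mulrDr mulrCA.
- apply: L2_ext.
  apply: filter_app (repr_mulop_indic F mA).
  apply: filterS (repr_mulop_indic (mulop \1_A F) mA) => x -> ->.
  by rewrite mulrA -rmorphM/= indicE; case: (_ \in _); rewrite ?mulr1 ?mulr0.
- rewrite -[LHS]/(L2dot mu _ _) -[RHS]/(L2dot mu _ _).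
  rewrite (L2dot_ae (measurable_realmul mI (measurable_repr F)) (measurable_repr G)
    (repr_mulop_indic F mA) (aeW _ (fun x => erefl))).
  rewrite (L2dot_ae (measurable_repr F) (measurable_realmul mI (measurable_repr G))
    (aeW _ (fun x => erefl)) (repr_mulop_indic G mA)).
  by congr cintegral; apply/funext => x; rewrite conjC_realmul mulrCA mulrA.
Qed.

Lemma mulop_indicC (A B : set X) F : measurable A -> measurable B ->
  mulop \1_A (mulop \1_B F) = mulop \1_B (mulop \1_A F).
Proof.
move=> mA mB; apply: L2_ext.
apply: filter_app (repr_mulop_indic F mA).
apply: filter_app (repr_mulop_indic F mB).
apply: filter_app (repr_mulop_indic (mulop \1_A F) mB).
apply: filterS (repr_mulop_indic (mulop \1_B F) mA) => x -> -> -> ->.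
by rewrite mulrCA.
Qed.

Lemma repr_sqnorm_integrable F :
  mu.-integrable setT (EFin \o (fun x => sqnorm (repr F x))).
Proof. exact: L2fun_integrable. Qed.

Lemma sum_indic_trivIset (T : Type) (S : nat -> set T) (n m : nat) (y : T) :
  trivIset setT S -> S m y -> \sum_(i < n) \1_(S i) y = (m < n)%N%:R :> R.
Proof.
move=> /trivIsetP tS Smy.
have S0 i : i != m -> \1_(S i) y = 0 :> R.
  move=> im; rewrite indicE memNset// => Siy.
  by have := tS i m I I im; rewrite -subset0 => /(_ y); apply.
have [mn|nm] := ltnP m n.
  rewrite (bigD1 (Ordinal mn))//= big1 ?addr0; first by rewrite indicE mem_set.
  by move=> i im; apply: S0; apply: contra im => /eqP im; apply/eqP/val_inj.
by rewrite big1// => i _; rewrite S0// neq_ltn (leq_trans (ltn_ord i) nm).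
Qed.

(** Pointwise the error [\sum_(i < n) \1_(S i) - \1_(\bigcup_n S n)] is [0] or
    [-1], and it vanishes as soon as [n] passes the index of the only [S m] that
    contains the point; dominated convergence with bound [|F|^2] concludes. *)
Lemma cvg_mulop_indic (S : nat -> set X) F :
  (forall n, measurable (S n)) -> trivIset setT S ->
  hcvg (L2dot mu) (fun n => \sum_(i < n) mulop \1_(S i) F)
    (mulop \1_(\bigcup_n S n) F).
Proof.
move=> mS tS; have mU : measurable (\bigcup_n S n) by exact: bigcupT_measurable.
pose c n x : R := \sum_(i < n) \1_(S i) x - \1_(\bigcup_n S n) x.
have cE x : (forall n, c n x = 0) \/ exists m, forall n, c n x = (m < n)%N%:R - 1.
  have [[m _ Smx]|nS] := pselect ((\bigcup_n S n) x).
    right; exists m => n; rewrite /c (sum_indic_trivIset _ tS Smx).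
    by rewrite indicE mem_set//; exists m.
  left => n; rewrite /c big1 ?indicE ?memNset ?subrr// => i _.
  by rewrite indicE memNset// => Six; apply: nS; exists i.
have mc n : measurable_fun setT (c n).
  by apply: measurable_funB; [apply: measurable_sum => i|]; exact: measurable_indic.
apply: (@hcvg_dominated _ _ _ _ _ _ (fun x => sqnorm (repr F x)) c) => //.
- exact: repr_sqnorm_integrable.
- by move=> x; exact: sqnorm_ge0.
- move=> n x; have [->|[m ->]] := cE x; first by rewrite normr0.
  by case: (m < n)%N; rewrite ?subrr ?sub0r ?normrN ?normr1 ?normr0.
- move=> x; have [c0|[m cm]] := cE x.
    by under eq_fun do rewrite c0; exact: cvg_cst.
  apply: cvg_near_cst; near=> n; rewrite cm.
  by rewrite (_ : (m < n)%N) ?subrr//; near: n; exact: nbhs_infty_gt.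
- move=> n; rewrite (integral_sqnorm_ae (measurable_repr _)
    (measurable_realmul (mc n) (measurable_repr F))).
    by apply: eq_integral => x _; rewrite sqnorm_realmul.
  have allS : {ae mu, forall x, forall i, repr (mulop \1_(S i) F) x =
      (\1_(S i) x)%:C * repr F x}.
    by apply/ae_foralln => i; exact: repr_mulop_indic.
  apply: filter_app allS; apply: filter_app (repr_mulop_indic F mU).
  apply: filter_app (repr_sub (\sum_(i < n) mulop \1_(S i) F)
    (mulop \1_(\bigcup_n S n) F)).
  apply: filterS (repr_sum (index_enum 'I_n) (fun i : 'I_n => mulop \1_(S i) F)) => x.
  move=> -> -> -> Sx; rewrite /c rmorphB/= mulrBl rmorph_sum/= mulr_suml.
  by congr (_ - _); apply: eq_bigr => i _; exact: Sx.
Unshelve. all: by end_near. Qed.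

End multiplication_operator.

Section truncation.
Context (R : realType) d (X : measurableType d) (mu : {measure set X -> \bar R}).

Lemma measurable_sublevel (g : X -> R) (c : R) :
  measurable_fun setT g -> measurable [set x | g x <= c].
Proof.
move=> mg; rewrite -[X in measurable X]setTI.
have := mg measurableT _ (measurable_itv `]-oo, c]%R).
by congr (measurable (_ `&` _)); apply/funext => x; rewrite /= in_itv.
Qed.

Lemma truncated_weight_finite (g : X -> R) (S : set X) (c : R) (u F : L2 mu) :
  measurable_fun setT g -> (forall x, 0 <= g x) -> measurable S -> 0 <= c ->
  (forall x, S x -> g x <= c) ->
  {ae mu, forall x, repr u x = (\1_S x)%:C * repr F x} ->
  (\int[mu]_x (g x * sqnorm (repr u x))%:E < +oo)%E.
Proof.
move=> mg g0 mS c0 gc uE.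
have mIF : measurable_fun setT (fun x => (\1_S x)%:C * repr F x).
  by apply: measurable_realmul (measurable_repr F); exact: measurable_indic.
have msq f : measurable_fun setT f ->
    measurable_fun setT (fun x => (g x * sqnorm (f x))%:E).
  move=> mf; apply/measurable_EFinP; apply: measurable_funM => //.
  exact: measurable_sqnorm.
rewrite (@ae_eq_integral _ _ _ mu _
  (fun x => (g x * sqnorm ((\1_S x)%:C * repr F x))%:E))//; first last.
- by apply: filterS uE => x ->.
- exact: msq.
- exact/msq/measurable_repr.
apply: (@le_lt_trans _ _ (\int[mu]_x (c%:E * (sqnorm (repr F x))%:E))%E).
  apply: ge0_le_integral => //=.
  - by move=> x _; rewrite lee_fin mulr_ge0// sqnorm_ge0.
  - exact: msq.
  - apply: measurable_funeM; apply/measurable_EFinP.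
    exact/measurable_sqnorm/measurable_repr.
  - move=> x _; rewrite -EFinM lee_fin sqnorm_realmul mulrA ler_wpM2r ?sqnorm_ge0//.
    rewrite indicE; have [/set_mem/= /gc|_] := boolP (x \in S).
      by rewrite expr1n mulr1.
    by rewrite expr0n mulr0.
have [mF Fi] := repr_square_integrable F.
rewrite ge0_integralZl//; last 2 first.
  by apply/measurable_EFinP; exact: measurable_sqnorm.
  by move=> x _; rewrite lee_fin sqnorm_ge0.
by rewrite lte_mul_pinfty.
Qed.
End truncation.

(** * Operators with a weighted quadratic form *)

Section weighted_form.
Context (R : realType) d (X : measurableType d) (mu : {measure set X -> \bar R}).
Variable h : X -> R.
Hypotheses (mh : measurable_fun setT h) (h0 : forall x, 0 <= h x).
Implicit Types F G : L2 mu.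

(** The spectral measure of the multiplication operator by [h]. *)
Definition spectral_proj (s : set R[i]) : L2 mu -> L2 mu :=
  mulop \1_((fun x => (h x)%:C) @^-1` s).

Lemma measurable_preimage_RtoC (s : set R[i]) : measurable s ->
  measurable ((fun x => (h x)%:C) @^-1` s).
Proof. by move=> ms; rewrite -[X in measurable X]setTI; exact: measurable_RtoC. Qed.

Lemma spectral_proj_pvm : projection_valued_measure (L2dot mu) spectral_proj.
Proof.
split=> [s ms|F|S F mS tS].
- exact/mulop_indic_projection/measurable_preimage_RtoC.
- rewrite /spectral_proj preimage_setT mulop.unlock; apply: L2_class_repr.
    apply: measurable_realmul (measurable_repr F); exact: measurable_indic.
  by apply: aeW => x; rewrite indicT mul1r.
- rewrite /spectral_proj preimage_bigcup; apply: cvg_mulop_indic.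
    by move=> n; exact: measurable_preimage_RtoC.
  apply/trivIsetP => i j _ _ ij; rewrite -preimage_setI.
  by move/trivIsetP : tS => /(_ i j I I ij) ->; rewrite preimage_set0.
Qed.

(** The measure [<E(.) F, F>] is the image under [h] of the measure with density
    [|F|^2]. *)
Lemma scalar_measure_spectral_proj F s : measurable s ->
  scalar_measure (L2dot mu) spectral_proj F s =
  density mu (fun x => sqnorm (repr F x)) ((fun x => (h x)%:C) @^-1` s).
Proof.
move=> /measurable_preimage_RtoC ms.
have mI : measurable_fun setT (\1_((fun x => (h x)%:C) @^-1` s) : X -> R).
  exact: measurable_indic.
rewrite /scalar_measure -[X in complex.Re X]/(L2dot mu _ _).
rewrite (L2dot_ae (measurable_realmul mI (measurable_repr F)) (measurable_repr F)
    (repr_mulop_indic F ms) (aeW _ (fun x => erefl))).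
rewrite /density integral_mkcond /= fineK.
  by apply: eq_integral => x _; rewrite -mulrA mul_conjC -rmorphM/= epatch_indic/= muleC.
apply: integrable_fin_num => //.
apply: (le_integrable measurableT _ _ (repr_sqnorm_integrable F)).
  apply/measurable_EFinP.
  rewrite (_ : (fun x => _) = (fun x =>
    \1_((fun x => (h x)%:C) @^-1` s) x * sqnorm (repr F x))).
    apply: measurable_funM => //; exact/measurable_sqnorm/measurable_repr.
  by apply/funext => x; rewrite -mulrA mul_conjC -rmorphM.
move=> x _ /=; rewrite -mulrA mul_conjC -rmorphM/= lee_fin normrM.
by rewrite ler_piMl// normr_indic.
Qed.

Variable T : operator (L2 mu).
Hypothesis domT : forall F, dom T F <->
  (\int[mu]_x (h x * sqnorm (repr F x))%:E < +oo)%E.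
Hypothesis formT : forall F G, dom T F -> dom T G -> L2dot mu (T F) (T G) =
  cintegral mu (fun x => (h x)%:C * (repr F x * Num.conj (repr G x))).

(** Let [D = z - h F] and test the adjoint relation against [u = \1_(h <= j) D],
    which is in [L2] because [h F] is there truncated where [h] is bounded, and is
    in the domain of [T] for the same reason.  The relation then reads
    [<u, D> = 0], that is [<u, u> = 0], so [D] vanishes almost everywhere on
    each [{h <= j}]. *)
Lemma adjoint_graph_weighted_form F z : dom T F ->
  adjoint_graph (L2dot mu) T (T F) z ->
  {ae mu, forall x, repr z x = (h x)%:C * repr F x}.
Proof.
move=> dF adj.
pose S (j : nat) := [set x | h x <= j%:R].
have mS j : measurable (S j) by exact: measurable_sublevel.
have mI j : measurable_fun setT (\1_(S j) : X -> R) by exact: measurable_indic.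
pose c j x := \1_(S j) x * h x.
have mc j : measurable_fun setT (c j) by exact: measurable_funM.
have cb j x : `|c j x| <= j%:R.
  rewrite /c indicE; have [/set_mem/= hj|_] := boolP (x \in S j).
    by rewrite mul1r ger0_norm.
  by rewrite mul0r normr0.
suff zero j : mulop \1_(S j) z - mulop (c j) F = 0.
  have allS : {ae mu, forall x, forall j, (\1_(S j) x)%:C * repr z x =
      (c j x)%:C * repr F x}.
    apply/ae_foralln => j.
    apply: filter_app (repr_mulop F (mc j) (cb j)).
    apply: filter_app (repr_mulop_indic z (mS j)).
    apply: filter_app (repr0 mu).
    apply: filterS (repr_sub (mulop \1_(S j) z) (mulop (c j) F)) => x.
    by rewrite zero => -> e0 <- <-; apply/eqP; rewrite -subr_eq0 e0.
  apply: filterS allS => x Sx.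
  have [j hj] : exists j : nat, h x <= j%:R.
    by exists (Num.truncn (h x)).+1; exact/ltW/truncnS_gt.
  have := Sx j; rewrite /c indicE mem_set; last exact: hj.
  by rewrite !mul1r.
set u := mulop \1_(S j) z - mulop (c j) F.
have uE : {ae mu, forall x, repr u x = (\1_(S j) x)%:C * repr u x}.
  apply: filter_app (repr_mulop F (mc j) (cb j)).
  apply: filter_app (repr_mulop_indic z (mS j)).
  apply: filterS (repr_sub (mulop \1_(S j) z) (mulop (c j) F)) => x.
  move=> -> -> ->; rewrite /c mulrBr !mulrA -!rmorphM/= mulrA.
  by rewrite indicE; case: (_ \in _); rewrite ?mulr1 ?mulr0 ?mul0r.
have du : dom T u.
  by apply/domT; apply: (truncated_weight_finite mh h0 (mS j) (ler0n R j) _ uE).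
have mR := measurable_repr.
have e1 : L2dot mu u z = L2dot mu u (mulop \1_(S j) z).
  rewrite (L2dot_ae (measurable_realmul (mI j) (mR _ _ _ _ u)) (mR _ _ _ _ z) uE
    (aeW _ (fun x => erefl))).
  rewrite (L2dot_ae (mR _ _ _ _ u) (measurable_realmul (mI j) (mR _ _ _ _ z))
    (aeW _ (fun x => erefl)) (repr_mulop_indic z (mS j))).
  by congr cintegral; apply/funext => x; rewrite conjC_realmul mulrCA mulrA.
have e2 : L2dot mu (T u) (T F) = L2dot mu u (mulop (c j) F).
  rewrite formT// (L2dot_ae (mR _ _ _ _ u) (measurable_realmul (mc j) (mR _ _ _ _ F))
    (aeW _ (fun x => erefl)) (repr_mulop F (mc j) (cb j))).
  apply: ae_eq_cintegral.
  - by apply: measurable_realmul => //; exact: measurable_mul_conj.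
  - by apply: measurable_mul_conj => //; exact: measurable_realmul.
  - apply: filterS uE => x ux; rewrite {1}ux conjC_realmul /c rmorphM/=.
    ring.
have /eqP : L2dot mu u u = 0.
  have -> : L2dot mu u u = L2dot mu u (mulop \1_(S j) z) - L2dot mu u (mulop (c j) F).
    exact: linearBr.
  by rewrite -e1 -e2 (adj u du) subrr.
by apply: contraTeq => /L2dot_gt0 u0; rewrite gt_eqF.
Qed.

(** If [T] has the quadratic form [\int h |F|^2] on its maximal domain, then the
    product of its adjoint with [T] is multiplication by [h] on its maximal
    domain.  A function [F] with [h F] in [L2] is in the domain of [T] because
    [h |F|^2 <= |F|^2 + |h F|^2]; conversely the previous lemma identifies the value of
    the adjoint at [T F] with [h F]. *)
Lemma spectral_measure_weighted_form :
  spectral_measure_of (L2dot mu)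
    (op_comp (adjoint (L2dot mu) T) T) spectral_proj.
Proof.
have mhC := measurable_RtoC mh.
have msq F : measurable_fun setT (fun x => sqnorm (repr F x)).
  exact/measurable_sqnorm/measurable_repr.
have mid : measurable_fun setT (@id R[i]) by exact: measurable_id.
have norm_hF F : (\int[mu]_x (sqnorm ((h x)%:C * repr F x))%:E =
    \int[scalar_measure (L2dot mu) spectral_proj F]_z (sqnorm z)%:E)%E.
  rewrite (integral_image_density (msq F) _ mhC (@scalar_measure_spectral_proj F)).
  - by apply: eq_integral => x _; rewrite sqnorm_realmul sqnorm_real mulrC.
  - by move=> x; exact: sqnorm_ge0.
  - exact: (measurable_sqnorm mid).
have mhF F := measurable_realmul mh (measurable_repr F).
split; first exact: spectral_proj_pvm.
- apply/seteqP; split=> F /=.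
    move=> [dF [z /(adjoint_graph_weighted_form dF) zE]].
    rewrite -norm_hF -(integral_sqnorm_ae (measurable_repr z) (mhF F) zE).
    by have [] := repr_square_integrable z.
  rewrite -norm_hF => hF.
  have hFi : square_integrable mu (fun x => (h x)%:C * repr F x) by [].
  have dF : dom T F.
    apply/domT; have [_ Fi] := repr_square_integrable F.
    apply: le_lt_trans (lte_add_pinfty Fi hF); rewrite -ge0_integralD//=.
    - apply: ge0_le_integral => //=.
      + by move=> x _; rewrite lee_fin mulr_ge0// sqnorm_ge0.
      + by apply/measurable_EFinP; exact: measurable_funM.
      + apply: emeasurable_funD; apply/measurable_EFinP => //.
        exact: measurable_sqnorm.
      + move=> x _; rewrite -EFinD lee_fin sqnorm_realmul.
        have s0 := sqnorm_ge0 (repr F x).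
        have := mulr_ge0 (sqr_ge0 (h x - 1)) s0.
        by have := mulr_ge0 (h0 x) s0; nra.
    - by move=> x _; rewrite lee_fin sqnorm_ge0.
    - exact/measurable_EFinP.
    - by move=> x _; rewrite lee_fin sqnorm_ge0.
    - by apply/measurable_EFinP; exact: measurable_sqnorm.
  split=> //; exists (L2_class mu (fun x => (h x)%:C * repr F x)) => G dG.
  rewrite -[LHS]/(L2dot mu _ _) -[RHS]/(L2dot mu _ _) formT//.
  rewrite (L2dot_ae (measurable_repr G) (mhF F) (aeW _ (fun x => erefl))
    (repr_L2_class hFi)).
  by congr cintegral; apply/funext => x; rewrite conjC_realmul mulrCA.
- move=> F /= [dF ex].
  have := xgetPex 0 ex; set z := xget _ _ => /(adjoint_graph_weighted_form dF) zE.
  rewrite -[LHS]/(L2dot mu z F).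
  rewrite (L2dot_ae (mhF F) (measurable_repr F) zE (aeW _ (fun x => erefl))).
  rewrite (cintegral_image_density (msq F) _ mhC (@scalar_measure_spectral_proj F)) => //.
    by congr cintegral; apply/funext => x; rewrite -mulrA mul_conjC mulrC.
  by move=> x; exact: sqnorm_ge0.
Qed.
End weighted_form.

(** * Exhaustions obtained from dense subspaces *)

Section chebyshev.
Context (R : realType) d (X : measurableType d).

Lemma sqnorm_chebyshev (m : {measure set X -> \bar R}) (f : X -> R[i]) :
  measurable_fun setT f ->
  ((4^-1 : R)%:E * m [set x | 4^-1 <= sqnorm (f x)]%R <=
    \int[m]_x (sqnorm (f x))%:E)%E.
Proof.
move=> mf; have mE : measurable_fun setT (fun x => (sqnorm (f x))%:E).
  by apply/measurable_EFinP; exact: measurable_sqnorm.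
have := le_integral_abse m measurableT (a := 4^-1) mE.
rewrite setTI (eq_integral (fun x => (sqnorm (f x))%:E)); last first.
  by move=> x _; rewrite gee0_abs// lee_fin sqnorm_ge0.
rewrite [X in (_ * m X)%E](_ : _ = [set x | 4^-1 <= sqnorm (f x)]%R).
  by apply; rewrite invr_gt0.
by apply/funext => x; rewrite /= lee_fin ger0_norm ?sqnorm_ge0.
Qed.

End chebyshev.

Section dense_exhaustion.
Context (R : realType) d (X : measurableType d).
Variables (mu : {sigma_finite_measure set X -> \bar R})
  (nu : {measure set X -> \bar R}) (D : set (L2 mu)).
Hypotheses (dense_D : hdense (L2dot mu) D)
  (finD : forall F, D F -> (\int[nu]_x (sqnorm (repr F x))%:E < +oo)%E).

(** Exhaust [mu] by sets [Y n] of finite measure, approximate the indicator of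
    [Y n] by some [F n] in [D] up to [1/(n+1)], and let [A n] be the set where
    [|F n|^2 >= 1/4].  By Chebyshev [nu (A n)] is finite.  On [Y n] outside [A n]
    the function [\1_(Y n) - F n] has modulus at least [1/2], so Chebyshev makes that
    set small: the points of [Y m] that escape every [A n] lie in sets of
    arbitrarily small measure. *)
Lemma dense_exhaustion : exists A : nat -> set X,
  [/\ forall n, measurable (A n), forall n, (nu (A n) < +oo)%E
    & mu (~` \bigcup_n A n) = 0%E].
Proof.
have /sigma_finiteP[Y [YT ndY /all_and2[mY Yfin]]] := sigma_finiteT mu.
have Yi n : square_integrable mu (fun x => (\1_(Y n) x)%:C).
  split; first by apply: measurable_RtoC; exact: measurable_indic.
  rewrite (eq_integral (fun x => (\1_(Y n) x)%:E)); last first.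
    move=> x _; rewrite sqnorm_real indicE.
    by case: (_ \in _); rewrite ?expr1n ?expr0n.
  rewrite integral_indic // setIT; exact: Yfin.
have /choice[F FP] : forall n, exists F, D F /\
    hnorm (L2dot mu) (L2_class mu (fun x => (\1_(Y n) x)%:C) - F) < n.+1%:R^-1.
  move=> n; have [|F DF FY] := dense_D (L2_class mu (fun x => (\1_(Y n) x)%:C))
    (e := n.+1%:R^-1); first by rewrite invr_gt0.
  by exists F.
have mF n := measurable_repr (F n).
pose A n := [set x | 4^-1 <= sqnorm (repr (F n) x)].
have mge (f : X -> R[i]) : measurable_fun setT f ->
    measurable [set x | 4^-1 <= sqnorm (f x)].
  move=> /measurable_sqnorm mf; rewrite -[X in measurable X]setTI.
  have := mf measurableT _ (measurable_itv `[4^-1, +oo[%R).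
  by congr (measurable (_ `&` _)); apply/funext => x; rewrite /= in_itv/= andbT.
have mA n : measurable (A n) by exact: mge.
exists A; split=> // [n|].
  have := le_lt_trans (sqnorm_chebyshev nu (mF n)) (finD (FP n).1).
  rewrite -/(A n); case: (nu (A n)) (measure_ge0 nu (A n)) => [r _ _||//].
    exact: ltry.
  by rewrite gt0_muley ?lte_fin ?invr_gt0.
set B := ~` _; have mB : measurable B by apply: measurableC; exact: bigcupT_measurable.
have small n : (mu (B `&` Y n) <= (4 * n.+1%:R^-1)%:E)%E.
  pose f x := (\1_(Y n) x)%:C - repr (F n) x.
  have mf : measurable_fun setT f.
    apply: (@measurable_complexD _ _ _ _ (fun x => - repr (F n) x)).
      by have [] := Yi n.
    rewrite (_ : (fun x => _) = (fun x => -1 * repr (F n) x)).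
      exact: measurable_complex_scale.
    by apply/funext => x; rewrite mulN1r.
  have fE : {ae mu, forall x,
      repr (L2_class mu (fun x => (\1_(Y n) x)%:C) - F n) x = f x}.
    apply: filter_app (repr_L2_class (Yi n)).
    by apply: filterS (repr_sub (L2_class mu (fun x => (\1_(Y n) x)%:C)) (F n)) => x -> ->.
  have fi : (\int[mu]_x (sqnorm (f x))%:E < +oo)%E.
    by have [] := square_integrable_ae mf fE (repr_square_integrable _).
  have f0 : (0 <= \int[mu]_x (sqnorm (f x))%:E)%E.
    by apply: integral_ge0 => x _; rewrite lee_fin sqnorm_ge0.
  have small_f : (\int[mu]_x (sqnorm (f x))%:E <= (n.+1%:R^-1)%:E)%E.
    have := (FP n).2; rewrite (hnormE mf fE) => /ltW sq.
    rewrite -[leLHS]fineK ?ge0_fin_numE// lee_fin.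
    rewrite -[leLHS]sqr_sqrtr ?fine_ge0//.
    apply: le_trans (_ : (n.+1%:R^-1) ^+ 2 <= _).
      by rewrite lerXn2r ?nnegrE// sqrtr_ge0.
    by rewrite expr2 ler_piMr// invf_le1// ler1n.
  have BYf : B `&` Y n `<=` [set x | 4^-1 <= sqnorm (f x)].
    move=> x [Bx Yx] /=; have {}Bx : sqnorm (repr (F n) x) < 4^-1.
      by rewrite ltNge; apply/negP => Anx; apply: Bx; exists n.
    move: Bx; rewrite /f indicE mem_set//; case: (repr (F n) x) => a b.
    by rewrite /sqnorm/=; nra.
  have muBY : (mu (B `&` Y n) <= mu [set x | 4^-1 <= sqnorm (f x)]%R)%E.
    by apply: le_measure; rewrite ?inE//; [exact: measurableI|exact: mge].
  apply: (le_trans muBY).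
  have : ((4^-1 : R)%:E * mu [set x | 4^-1 <= sqnorm (f x)]%R <=
      (n.+1%:R^-1)%:E)%E by exact: le_trans (sqnorm_chebyshev mu mf) small_f.
  set M := mu _; have : (0 <= M)%E by exact: measure_ge0.
  case: M => [r _|_|//]; first by rewrite -EFinM !lee_fin ler_pdivrMl.
  by rewrite gt0_muley ?lte_fin ?invr_gt0.
have zero m : mu (B `&` Y m) = 0%E.
  apply/eqP; rewrite eq_le measure_ge0 andbT; apply/lee_addgt0Pr => e e0.
  rewrite add0e.
  have [k _ /(_ k (leqnn _)) /= ke] :=
    near_infty_natSinv_lt (PosNum (divr_gt0 e0 (ltr0n R 4))).
  apply: (@le_trans _ _ (mu (B `&` Y (maxn m k)))).
    apply: le_measure; rewrite ?inE; [exact: measurableI|exact: measurableI|].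
    by apply: setIS; apply/subsetPset/ndY; exact: leq_maxl.
  apply: le_trans (small _) _; rewrite lee_fin.
  have : (maxn m k).+1%:R^-1 <= k.+1%:R^-1 :> R.
    by rewrite lef_pV2 ?posrE// ler_nat ltnS leq_maxr.
  move: ke; rewrite ltr_pdivlMr// => /ltW ke le_inv; apply: le_trans ke.
  by rewrite mulrC ler_wpM2r.
apply/(negligibleP mu mB); rewrite -[B]setIT YT setI_bigcupr.
apply: negligible_bigcup => m; apply/negligibleP; last exact: zero.
exact: measurableI.
Qed.
End dense_exhaustion.

(** * Powers of weighted composition operators *)

Section weighted_composition_powers.
Context (R : realType) d (X : measurableType d).
Variables (mu : {sigma_finite_measure set X -> \bar R})
  (phi : X -> X) (w : X -> R[i]).
Hypotheses (mphi : measurable_fun [set: X] phi) (mw : measurable_fun [set: X] w)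
  (wd : wcomp_well_defined mu phi w).
Local Notation T := (wcomp mu phi w).

Definition wcomp_fun (f : X -> R[i]) (x : X) := w x * f (phi x).
Local Notation weight n := (iter n wcomp_fun (cst 1)).

(** Well-definedness: a [mu]-null set where [f] and [g] differ is pulled back by
    [phi] to a set that is null for [|w|^2 mu], that is, to one on which [w]
    vanishes almost everywhere. *)
Lemma wcomp_fun_ae f g : {ae mu, forall x, f x = g x} ->
  {ae mu, forall x, wcomp_fun f x = wcomp_fun g x}.
Proof.
move=> [N [mN N0 fgN]].
have mphiN : measurable (phi @^-1` N) by rewrite -[X in measurable X]setTI; exact: mphi.
have mw2 : measurable_fun (phi @^-1` N) (fun x => (sqnorm (w x))%:E).
  by apply: measurable_funTS; apply/measurable_EFinP; exact: measurable_sqnorm.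
have := (null_content_dominatesP _ _).1 wd N mN N0; rewrite /weighted_measure.
rewrite (eq_integral (fun x => `|(sqnorm (w x))%:E|%E)); last first.
  by move=> x _; rewrite gee0_abs// lee_fin sqnorm_ge0.
move/(ae_eq_integral_abs mu mphiN mw2); apply: filterS => x wx.
rewrite /wcomp_fun; have [Nx|Nx] := pselect (N (phi x)).
  have [/eqP] := wx Nx; rewrite /sqnorm paddr_eq0 ?sqr_ge0// !sqrf_eq0.
  move=> /andP[/eqP re0 /eqP im0].
  by rewrite (_ : w x = 0) ?mul0r//; apply/eqP; rewrite eq_complex re0 im0 !eqxx.
by congr (_ * _); apply: contrapT => fg; apply: Nx; exact: fgN.
Qed.

Lemma iter_wcomp_fun_ae n f g : {ae mu, forall x, f x = g x} ->
  {ae mu, forall x, iter n wcomp_fun f x = iter n wcomp_fun g x}.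
Proof. by move=> fg; elim: n => //= n; exact: wcomp_fun_ae. Qed.

Lemma measurable_wcomp_fun f : measurable_fun setT f -> measurable_fun setT (wcomp_fun f).
Proof. by move=> mf; apply: measurable_complexM => //; exact: measurableT_comp. Qed.

Lemma measurable_iter_wcomp_fun n f :
  measurable_fun setT f -> measurable_fun setT (iter n wcomp_fun f).
Proof. by move=> mf; elim: n => //= n; exact: measurable_wcomp_fun. Qed.

Lemma measurable_iter_phi n : measurable_fun setT (iter n phi).
Proof. by elim: n => [|n IHn] /=; [exact: measurable_id|exact: measurableT_comp]. Qed.

Lemma iter_wcomp_funE n f x : iter n wcomp_fun f x = weight n x * f (iter n phi x).
Proof.
elim: n x => [|n IHn] x; first by rewrite mul1r.
by rewrite -[LHS]/(w x * iter n wcomp_fun f (phi x)) IHn mulrA [iter n.+1 phi x]iterSr.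
Qed.

(** The two halves are proved together: the next factor of the domain condition
    is stated on the representative of [T^n F], which is only known almost
    everywhere. *)
Lemma op_powP n (F : L2 mu) :
  (dom (op_pow T n) F <->
    forall k, (k <= n)%N -> square_integrable mu (iter k wcomp_fun (repr F))) /\
  (dom (op_pow T n) F ->
    {ae mu, forall x, repr (op_pow T n F) x = iter n wcomp_fun (repr F) x}).
Proof.
elim: n => [|n [domn reprn]].
  split; last by move=> _; exact: aeW.
  split=> // _ k; rewrite leqn0 => /eqP ->; exact: repr_square_integrable.
have stepn : dom (op_pow T n) F -> {ae mu, forall x,
    wcomp_fun (repr (op_pow T n F)) x = iter n.+1 wcomp_fun (repr F) x}.
  by move=> dF; exact: wcomp_fun_ae (reprn dF).
have mF := measurable_repr F.
have step_sqint : dom (op_pow T n) F ->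
    (dom T (op_pow T n F) <-> square_integrable mu (iter n.+1 wcomp_fun (repr F))).
  move=> dF; split.
    by apply: (square_integrable_ae _ (stepn dF)); exact: measurable_iter_wcomp_fun.
  apply: square_integrable_ae.
    by apply: measurable_wcomp_fun; exact: measurable_repr.
  by apply: filterS (stepn dF) => x /esym.
split.
  split=> [[dF dT] k|Fi].
    rewrite leq_eqVlt => /orP[/eqP ->|]; first exact/(step_sqint dF).
    by rewrite ltnS; exact: (domn.1 dF).
  have dF : dom (op_pow T n) F by apply/domn => k kn; apply: Fi; exact: leqW.
  by split=> //; apply/(step_sqint dF); exact: Fi.
move=> [dF dT]; apply: filter_app (stepn dF).
by apply: filterS (repr_L2_class dT) => x; exact: etrans.
Qed.

Definition op_pow_dom n F := (op_powP n F).1.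
Definition repr_op_pow n F := (op_powP n F).2.

Lemma wcomp_linear : linear_operator T.
Proof.
have mR := @measurable_repr R d X mu.
have mst F := measurable_wcomp_fun (mR F).
split.
  apply: (square_integrable_ae (f := cst 0)); first exact: mst.
    have := wcomp_fun_ae (repr0 mu); apply: filterS => x.
    by rewrite /wcomp_fun => ->; rewrite mulr0.
  have [_] := sqint_submod_closed mu; have [/asboolP + _] := sqint_submod_closed mu.
  by [].
move=> a F G dF dG.
have lin : {ae mu, forall x, a * wcomp_fun (repr F) x + wcomp_fun (repr G) x =
    wcomp_fun (repr (a *: F + G)) x}.
  apply: filterS (wcomp_fun_ae (repr_linear a F G)) => x ->.
  by rewrite /wcomp_fun mulrDr mulrCA.
have mlin : measurable_fun setT (fun x => a * wcomp_fun (repr F) x + wcomp_fun (repr G) x).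
  by apply: measurable_complexD => //; exact: measurable_complex_scale.
split.
  apply: (square_integrable_ae (mst _) lin).
  have /asboolP := (sqint_submod_closed mu).2 a (wcomp_fun (repr F)) (wcomp_fun (repr G))
    (introT (asboolP _) dF) (introT (asboolP _) dG).
  by [].
apply: L2_class_repr; first exact: mst.
have reprT H : dom T H -> {ae mu, forall x, repr (T H) x = wcomp_fun (repr H) x}.
  exact: repr_L2_class.
apply: filter_app lin; apply: filter_app (reprT F dF); apply: filter_app (reprT G dG).
by apply: filterS (repr_linear a (T F) (T G)) => x e eG eF; rewrite e eF eG.
Qed.

(** The image under [phi^n] of [|w_n|^2 mu], where [w_n] is the product of the
    [w \o phi^k] for [k < n]; the integral of [|F|^2] against it
    is [||T^n F||^2]. *)
Definition power_measure n : set X -> \bar R := fun s =>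
  density mu (fun x => sqnorm (weight n x)) (iter n phi @^-1` s).

Lemma measurable_sqweight n : measurable_fun setT (fun x => sqnorm (weight n x)).
Proof. by apply/measurable_sqnorm/measurable_iter_wcomp_fun; exact: measurable_cst. Qed.

(** The powers act on classes: applied to the indicator of a null set, [T^n]
    gives [0] almost everywhere, that is, [w_n] vanishes on its preimage. *)
Lemma power_measure_dominated n : power_measure n `<< mu.
Proof.
apply/null_content_dominatesP => s ms s0.
have m0 : measurable_fun setT (\1_s : X -> R) by exact: measurable_indic.
have s_ae : {ae mu, forall x, (\1_s x)%:C = cst 0 x :> R[i]}.
  exists s; split => // x /=; apply: contra_notP => nsx.
  by rewrite indicE memNset.
have w_ae := iter_wcomp_fun_ae n s_ae.
have zero_ae : {ae mu, forall x,
    sqnorm (weight n x) * \1_s (iter n phi x) = 0 :> R}.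
  apply: filterS w_ae => x; rewrite iter_wcomp_funE [RHS]iter_wcomp_funE mulr0 => wx.
  have := congr1 (@sqnorm R) wx; rewrite sqnormM sqnorm_real [RHS]/sqnorm/=.
  rewrite expr0n addr0 => /eqP; rewrite mulf_eq0 sqrf_eq0 => /orP[]/eqP ->.
    by rewrite mul0r.
  by rewrite mulr0.
rewrite /power_measure /density integral_mkcond.
rewrite (eq_integral (fun x => (sqnorm (weight n x) * \1_s (iter n phi x))%:E)).
  rewrite (@ae_eq_integral _ _ _ mu _ (cst 0%E))//; first by rewrite integral0.
    apply/measurable_EFinP; apply: measurable_funM; first exact: measurable_sqweight.
    exact: (measurableT_comp m0 (measurable_iter_phi n)).
  by apply: filterS zero_ae => x ->.
by move=> x _; rewrite epatch_indic.
Qed.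

Lemma integral_power_measure n (f : X -> R[i]) : measurable_fun setT f ->
  (\int[power_measure n]_x (sqnorm (f x))%:E =
   \int[mu]_x (sqnorm (iter n wcomp_fun f x))%:E)%E.
Proof.
move=> mf.
rewrite (integral_image_density (measurable_sqweight n) (fun x => sqnorm_ge0 _)
  (measurable_iter_phi n) (fun s _ => erefl) (measurable_sqnorm mf)).
by apply: eq_integral => x _; rewrite (iter_wcomp_funE n f) sqnormM.
Qed.

(** Density of the common domain is what makes the density of [power_measure n] finite:
    [\int |F|^2] against this measure is finite for every [F] there. *)
Lemma power_density : 
  hdense (L2dot mu) (\bigcap_(n in [set n : nat | (0 < n)%N]) dom (op_pow T n)) ->
  forall n, exists h : X -> R, [/\ measurable_fun setT h, forall x, 0 <= h x &
    forall s, measurable s -> power_measure n s = density mu h s].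
Proof.
move=> dense_dom n.
have mphin := measurable_iter_phi n.
have v0 x : 0 <= sqnorm (weight n x) by exact: sqnorm_ge0.
have [nu nuE] : exists nu : {measure set X -> \bar R},
    forall s, measurable s -> power_measure n s = nu s.
  exact: (image_density_is_measure (measurable_sqweight n) v0 mphin (fun s _ => erefl)).
have numu : nu `<< mu.
  apply/null_content_dominatesP => s ms s0; rewrite -nuE//.
  exact: (null_content_dominatesP _ _).1 (power_measure_dominated n) s ms s0.
have finD F : (\bigcap_(n in [set n : nat | (0 < n)%N]) dom (op_pow T n)) F ->
    (\int[nu]_x (sqnorm (repr F x))%:E < +oo)%E.
  move=> /(_ n.+1 isT) /op_pow_dom /(_ n (leqnSn n)) [_].
  by rewrite -(eq_integral_setfun _ nuE) integral_power_measure//; exact: measurable_repr.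
have [A [mA nuA muA]] := dense_exhaustion dense_dom finD.
have [h [mh h0 hE]] := radon_nikodym_exhaustion numu mA nuA muA.
by exists h; split=> // s ms; rewrite nuE// hE.
Qed.

Section closed_powers.
Variable h : nat -> X -> R.
Hypotheses (mh : forall n, measurable_fun setT (h n)) (h0 : forall n x, 0 <= h n x)
  (hE : forall n s, measurable s -> power_measure n s = density mu (h n) s).

Lemma integral_iter_wcomp_fun n (f : X -> R[i]) : measurable_fun setT f ->
  (\int[mu]_x (sqnorm (iter n wcomp_fun f x))%:E =
   \int[mu]_x (h n x * sqnorm (f x))%:E)%E.
Proof.
move=> mf; rewrite -integral_power_measure//.
exact: (integral_image_density (mh n) (h0 n) (psi := id) (@measurable_id _ _ _) (@hE n)
  (measurable_sqnorm mf)).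
Qed.

Lemma cintegral_iter_wcomp_fun n (f g : X -> R[i]) :
  measurable_fun setT f -> measurable_fun setT g ->
  cintegral mu (fun x => iter n wcomp_fun f x * Num.conj (iter n wcomp_fun g x)) =
  cintegral mu (fun x => (h n x)%:C * (f x * Num.conj (g x))).
Proof.
move=> mf mg; have mfg := measurable_mul_conj mf mg.
rewrite -(cintegral_image_density (mh n) (h0 n) (psi := id)
  (@measurable_id _ _ _) (@hE n) mfg).
rewrite (cintegral_image_density (measurable_sqweight n) (fun x => sqnorm_ge0 _)
  (measurable_iter_phi n) (fun s _ => erefl) mfg).
congr cintegral; apply/funext => x; rewrite iter_wcomp_funE (iter_wcomp_funE n g).
by rewrite rmorphM/= -mul_conjC; ring.
Qed.

(** The domain of [T^n] also asks for finiteness of [\int h_k |F|^2] with [k < n].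
    For closed [T^n] this comes for free.  Truncate [F] to the set where all [h_k],
    [k <= n], are bounded by [j]; the truncations are in the domain and tend to
    [F], and their images tend to [w_n (F \o phi^n)], which is in [L2] because
    [\int h_n |F|^2] is finite. *)
Lemma op_pow_dom_closed n F : closed_operator (L2dot mu) (op_pow T n) ->
  dom (op_pow T n) F <-> (\int[mu]_x (h n x * sqnorm (repr F x))%:E < +oo)%E.
Proof.
move=> clT; have mF := measurable_repr F.
split=> [/op_pow_dom/(_ n (leqnn n)) [_]|hF]; first by rewrite integral_iter_wcomp_fun.
(* A single bound on the sum controls all h_k with k <= n at once. *)
pose H x := \sum_(k < n.+1) h k x.
have mH : measurable_fun setT H by apply: measurable_sum => k; exact: mh.
have hH k x : (k <= n)%N -> h k x <= H x.
  move=> kn; rewrite /H (bigD1 (Ordinal (kn : (k < n.+1)%N)))//= lerDl.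
  by apply: sumr_ge0 => i _.
pose S (j : nat) := [set x | H x <= j%:R].
have mS j : measurable (S j) by exact: measurable_sublevel.
pose c j x : R := \1_(S j) x - 1.
have mc j : measurable_fun setT (c j).
  by apply: measurable_funB => //; exact: measurable_indic.
have c1 j x : `|c j x| <= 1.
  rewrite /c indicE; case: (_ \in _); rewrite ?subrr ?normr0//.
  by rewrite sub0r normrN normr1.
have c0 x : c j x @[j --> \oo] --> (0 : R).
  apply: cvg_near_cst; near=> j; rewrite /c indicE mem_set ?subrr//=.
  rewrite /S/=; apply/ltW/(lt_le_trans (truncnS_gt _)); rewrite ler_nat.
  by near: j; exact: nbhs_infty_ge.
pose u j := mulop \1_(S j) F.
have uE j : {ae mu, forall x, repr (u j) x = (\1_(S j) x)%:C * repr F x}.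
  exact: repr_mulop_indic.
have udom j : dom (op_pow T n) (u j).
  apply/op_pow_dom => k kn; split.
    exact/measurable_iter_wcomp_fun/measurable_repr.
  rewrite integral_iter_wcomp_fun; last exact: measurable_repr.
  apply: (truncated_weight_finite (mh k) (h0 k) (mS j) (ler0n R j) _ (uE j)) => x.
  by apply: le_trans; exact: hH.
have hFi : square_integrable mu (iter n wcomp_fun (repr F)).
  by split; [exact: measurable_iter_wcomp_fun|rewrite integral_iter_wcomp_fun].
have [] // := clT u F (L2_class mu (iter n wcomp_fun (repr F))) udom.
- apply: (hcvg_dominated (repr_sqnorm_integrable F) _ mc c1 c0) => [x|j].
    exact: sqnorm_ge0.
  rewrite (integral_sqnorm_ae (measurable_repr _) (measurable_realmul (mc j) mF)).
    by apply: eq_integral => x _; rewrite sqnorm_realmul.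
  apply: filter_app (uE j); apply: filterS (repr_sub (u j) F) => x -> ->.
  by rewrite /c rmorphB/= mulrBl mul1r.
- have hFint : mu.-integrable setT (EFin \o (fun x => h n x * sqnorm (repr F x))).
    apply/integrableP; split.
      by apply/measurable_EFinP; apply: measurable_funM => //; exact: measurable_sqnorm.
    under eq_integral do rewrite /= ger0_norm ?mulr_ge0 ?sqnorm_ge0//.
    exact: hF.
  apply: (hcvg_dominated hFint _ mc c1 c0) => [x|j].
    by rewrite mulr_ge0// sqnorm_ge0.
  have mcF := measurable_realmul (mc j) mF.
  rewrite (integral_sqnorm_ae (measurable_repr _) (measurable_iter_wcomp_fun n mcF)).
    rewrite integral_iter_wcomp_fun//.
    by apply: eq_integral => x _; rewrite sqnorm_realmul mulrCA.
  apply: filter_app (repr_L2_class hFi).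
  apply: filter_app (repr_op_pow (udom j)).
  apply: filter_app (iter_wcomp_fun_ae n (uE j)).
  apply: filterS (repr_sub (op_pow T n (u j)) (L2_class mu (iter n wcomp_fun (repr F)))) => x.
  move=> -> e1 -> ->; rewrite e1 iter_wcomp_funE (iter_wcomp_funE n (repr F)).
  rewrite [RHS]iter_wcomp_funE -mulrBr /c rmorphB/=.
  by rewrite [in RHS]mulrBl mul1r.
Unshelve. all: by end_near. Qed.

Lemma op_pow_form n F G : dom (op_pow T n) F -> dom (op_pow T n) G ->
  L2dot mu (op_pow T n F) (op_pow T n G) =
  cintegral mu (fun x => (h n x)%:C * (repr F x * Num.conj (repr G x))).
Proof.
move=> dF dG; have mR H := measurable_iter_wcomp_fun n (@measurable_repr R d X mu H).
rewrite (L2dot_ae (mR F) (mR G) (repr_op_pow dF) (repr_op_pow dG)).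
by apply: cintegral_iter_wcomp_fun; exact: measurable_repr.
Qed.

End closed_powers.
End weighted_composition_powers.

Theorem proposition2 (R : realType) (d : measure_display) (X : measurableType d)
    (mu : {sigma_finite_measure set X -> \bar R})
    (phi : X -> X) (w : X -> R[i])
    (mphi : measurable_fun [set: X] phi) (mw : measurable_fun [set: X] w)
    (wd : wcomp_well_defined mu phi w)
    (closed_pow : forall n : nat, (0 < n)%N ->
      closed_operator (L2dot mu) (op_pow (wcomp mu phi w) n))
    (dense_dom : hdense (L2dot mu)
      (\bigcap_(n in [set n : nat | (0 < n)%N])
        dom (op_pow (wcomp mu phi w) n))) :
  spectrally_half_centered (L2dot mu) (wcomp mu phi w).
Proof.
split; first exact: wcomp_linear.
  move=> n n0; split; last exact: closed_pow.
  move=> F e e0; have [G DG FG] := dense_dom F e e0.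
  by exists G => //; exact: DG.
have /choice[h /all_and3[mh h0 hE]] := power_density mphi mw wd dense_dom.
exists (fun n => @spectral_proj R d X mu (h n)); split=> [n n0|n m _ _ s t ms mt F].
  apply: spectral_measure_weighted_form => // [F|F G].
    by apply: op_pow_dom_closed => //; exact: closed_pow.
  exact: op_pow_form.
by apply: mulop_indicC; exact: measurable_preimage_RtoC.
Qed.
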